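(* Let $k$ be an algebraically closed field of characteristic zero. Let $X$ be an algebraic variety over $k$ with an action of an algebraic group $G$ (possibly non-reductive), and let $\pi: X \to \overline{X}$ be a pseudo-quotient for the action of $G$ on $X$. Then: (1) If $X \to \overline{X}'$ is another pseudo-quotient for the action of $G$ on $X$, then $[\overline{X}] = [\overline{X}']$ in the Grothendieck ring of algebraic varieties $\mathrm{K}\mathbf{Var}_k$. (2) More generally, if $X = Y \sqcup U$ where $Y \subseteq X$ is closed and $U \subseteq X$ is open and saturated for $\pi$ (that is, $\pi^{-1}(\pi(U)) = U$), then $[\overline{X}] = [\overline{Y}] + [\overline{U}]$ in $\mathrm{K}\mathbf{Var}_k$ for any pseudo-quotients $Y \to \overline{Y}$ and $U \to \overline{U}$ for the action of $G$ on $Y$ and $U$ respectively. (3) If $Y \subseteq X$ is a subvariety, $H \leq G$ is an algebraic subgroup and $(Y, H)$ is a core for the action of $G$ on $X$, then the restriction $\pi|_Y: Y \to \overline{X}$ is a pseudo-quotient for the action of $H$ on $Y$.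
   Context: Varieties are not assumed irreducible. Pseudo-quotient: for an algebraic group $G$ acting on a variety $X$, a pseudo-quotient is a surjective $G$-invariant regular morphism $\pi: X \to Y$ onto an algebraic variety $Y$ such that for any disjoint $G$-invariant closed sets $W_1, W_2 \subseteq X$ one has $\overline{\pi(W_1)} \cap \overline{\pi(W_2)} = \emptyset$ (Zariski closures). Orbitwise-closed: a subset $A \subseteq X$ is orbitwise-closed for the action of a group $H$ on $X$ if $\overline{Ha} \subseteq A$ for every $a \in A$. Core: a core for the action of $G$ on $X$ is a pair $(Y,H)$ of a subvariety $Y \subseteq X$ and an algebraic subgroup $H \leq G$ such that: (i) $Y$ is orbitwise-closed for the action of $H$; (ii) for any $x \in X$, $\overline{Gx} \cap Y \neq \emptyset$; (iii) for any two disjoint $H$-invariant subsets $W_1, W_2 \subseteq Y$ that are closed in $Y$, one has $\overline{GW_1} \cap \overline{GW_2} = \emptyset$ (closures in $X$). Grothendieck ring: $\mathrm{K}\mathbf{Var}_k$ is the commutative ring generated by isomorphism classes $[X]$ of algebraic varieties over $k$ modulo $[X] = [Y] + [X - Y]$ for $Y \subseteq X$ a closed subvariety, with product $[X]\cdot[Y] = [X \times Y]$. *)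

(* Defs.v *)
From HB Require Import structures.
From mathcomp Require Import all_boot all_order all_algebra.
From mathcomp Require Import all_classical topology.
From Stdlib Require Ring_theory.
From mathcomp Require Import -(notations) mpoly.

Set Implicit Arguments.
Unset Strict Implicit.
Unset Printing Implicit Defensive.

Import GRing.Theory.

Local Open Scope classical_set_scope.
Local Open Scope ring_scope.

(* Varieties over an algebraically closed field [k] are identified with their
   sets of closed points: a variety is a Zariski space with a sheaf of
   [k]-valued functions that is locally isomorphic to a closed subset of
   affine space (reduced, separated, of finite type, possibly reducible or
   empty). *)

(* [regular U] is the algebra of regular functions on the open set [U].  Its
   elements are total functions, of which only the values on [U] matter;
   [regular U] is irrelevant when [U] is not open. *)
HB.mixin Record Topological_isFunctionSpace (k : closedFieldType) T
    of Topological T := {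
  regular : set T -> set (T -> k);
  regular_ext : forall (U : set T) (f g : T -> k), open U ->
    (forall x, U x -> f x = g x) -> regular U f -> regular U g;
  regular_cst : forall (U : set T) (c : k), open U -> regular U (fun=> c);
  regularD : forall (U : set T) (f g : T -> k), open U ->
    regular U f -> regular U g -> regular U (fun x => f x + g x);
  regularM : forall (U : set T) (f g : T -> k), open U ->
    regular U f -> regular U g -> regular U (fun x => f x * g x);
  regularS : forall (U V : set T) (f : T -> k), open U -> open V ->
    V `<=` U -> regular U f -> regular V f;
  regular_glue : forall (U : set T) (f : T -> k), open U ->
    (forall x, U x -> exists V, [/\ open V, V x, V `<=` U & regular V f]) ->
    regular U f
}.

#[short(type="fspaceType")]
HB.structure Definition FunctionSpace (k : closedFieldType) :=
  {T of Topological T & Topological_isFunctionSpace k T}.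

Definition morphism (k : closedFieldType) (X Y : fspaceType k) (f : X -> Y) :=
  continuous f /\
  forall (V : set Y) (g : Y -> k), open V -> regular V g ->
    regular (f @^-1` V) (g \o f).

Definition isomorphic (k : closedFieldType) (X Y : fspaceType k) :=
  exists (f : X -> Y) (g : Y -> X),
    [/\ morphism f, morphism g, cancel f g & cancel g f].

Section Induced.
Context {k : closedFieldType} {X : fspaceType k} (A : set X).

(* The structure induced on a subset (for a locally closed subset, the reduced
   induced structure): functions that locally extend to regular functions on
   an open subset of the ambient space. *)
Definition induced_regular (V : set (set_type A)) : set (set_type A -> k) :=
  [set f | forall a, V a -> exists (U : set X) (F : X -> k),
    [/\ open U, U (set_val a), regular U F &
        forall b, V b -> U (set_val b) -> f b = F (set_val b)]].

Fact induced_ext (U : set (set_type A)) (f g : set_type A -> k) : open U ->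
  (forall x, U x -> f x = g x) -> induced_regular U f -> induced_regular U g.
Proof.
move=> _ fg + a Ua => /(_ a Ua)[V [F [oV Va rF fF]]]; exists V, F; split=> //.
by move=> b Ub Vb; rewrite -fg// fF.
Qed.

Fact induced_cst (U : set (set_type A)) (c : k) :
  open U -> induced_regular U (fun=> c).
Proof.
move=> _ a Ua; exists setT, (fun=> c); split=> //; first exact: openT.
by apply: regular_cst; exact: openT.
Qed.

Fact induced_op (op : k -> k -> k) :
  (forall (U : set X) (f g : X -> k), open U ->
    regular U f -> regular U g -> regular U (fun x => op (f x) (g x))) ->
  forall (U : set (set_type A)) (f g : set_type A -> k), open U ->
    induced_regular U f -> induced_regular U g ->
    induced_regular U (fun x => op (f x) (g x)).
Proof.
move=> rop U f g _ rf rg a Ua.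
have [V [F [oV Va rF fF]]] := rf a Ua.
have [W [G [oW Wa rG gG]]] := rg a Ua.
have oVW : open (V `&` W) by exact: openI.
exists (V `&` W), (fun x => op (F x) (G x)); split=> //.
  by apply: rop => //; [exact: regularS rF|exact: regularS rG].
by move=> b Ub [Vb Wb]; rewrite fF// gG.
Qed.

Fact inducedD (U : set (set_type A)) (f g : set_type A -> k) : open U ->
  induced_regular U f -> induced_regular U g ->
  induced_regular U (fun x => f x + g x).
Proof. exact: (induced_op (@regularD k X)). Qed.

Fact inducedM (U : set (set_type A)) (f g : set_type A -> k) : open U ->
  induced_regular U f -> induced_regular U g ->
  induced_regular U (fun x => f x * g x).
Proof. exact: (induced_op (@regularM k X)). Qed.

Fact inducedS (U V : set (set_type A)) (f : set_type A -> k) :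
  open U -> open V -> V `<=` U -> induced_regular U f -> induced_regular V f.
Proof.
move=> _ _ VU rf a Va; have [W [F [oW Wa rF fF]]] := rf a (VU _ Va).
by exists W, F; split=> // b Vb Wb; apply: fF => //; exact: VU.
Qed.

Fact induced_glue (U : set (set_type A)) (f : set_type A -> k) : open U ->
  (forall x, U x ->
    exists V, [/\ open V, V x, V `<=` U & induced_regular V f]) ->
  induced_regular U f.
Proof.
move=> _ Uf a Ua; have [V [[V' oV' <-] Va VU rf]] := Uf a Ua.
have [W [F [oW Wa rF fF]]] := rf a Va.
have oVW : open (V' `&` W) by exact: openI.
exists (V' `&` W), F; split=> //; first exact: regularS rF.
by move=> b Ub [Vb Wb]; exact: fF.
Qed.

HB.instance Definition _ := Topological_isFunctionSpace.Build k (set_type A)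
  induced_ext induced_cst inducedD inducedM inducedS induced_glue.

End Induced.

Section Affine.
Variables (k : closedFieldType) (n : nat).

(* An alias of ['rV[k]_n], so as not to inherit the topology of matrices. *)
Definition affine : Type := 'rV[k]_n.

HB.instance Definition _ := Choice.on affine.

Definition peval (p : mpoly n k) (x : affine) : k :=
  meval (fun i => (x : 'rV[k]_n) ord0 i) p.

Definition zariski_open : set (set affine) :=
  [set U | exists I : set (mpoly n k),
    U = [set x | exists2 p, I p & peval p x != 0]].

Lemma pevalM p q x : peval (p * q) x = peval p x * peval q x.
Proof. exact: mevalM. Qed.

Lemma pevalD p q x : peval (p + q) x = peval p x + peval q x.
Proof. exact: mevalD. Qed.

Lemma pevalC c x : peval (mpolyC n c) x = c.
Proof. exact: mevalC. Qed.

Fact zariski_openT : zariski_open setT.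
Proof.
exists setT; apply/esym/seteqP; split=> // x _.
by exists (mpolyC n 1) => //; rewrite pevalC oner_neq0.
Qed.

Fact zariski_openI : setI_closed zariski_open.
Proof.
move=> _ _ [I ->] [J ->].
exists [set r | exists p q, [/\ I p, J q & r = p * q]].
apply/seteqP; split=> [x [[p Ip px] [q Jq qx]]|x [_ [p [q [Ip Jq ->]]]]].
  by exists (p * q); [exists p, q|rewrite pevalM mulf_neq0].
by rewrite pevalM mulf_eq0 negb_or => /andP[px qx]; split; [exists p|exists q].
Qed.

Fact zariski_open_bigU (I : Type) (f : I -> set affine) :
  (forall i, zariski_open (f i)) -> zariski_open (\bigcup_i f i).
Proof.
move=> /choice[J fJ]; exists (\bigcup_i J i).
apply/seteqP; split=> [x [i _]|x [p [i _ Jp] px]].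
  by rewrite fJ => -[p Jp px]; exists p => //; exists i.
by exists i => //; rewrite fJ; exists p.
Qed.

HB.instance Definition _ := isOpenTopological.Build affine
  zariski_openT zariski_openI zariski_open_bigU.

Definition affine_regular (V : set affine) : set (affine -> k) :=
  [set f | forall x, V x -> exists p q, peval q x != 0 /\
    forall y, V y -> peval q y != 0 -> f y = peval p y / peval q y].

Fact affine_ext (U : set affine) (f g : affine -> k) : open U ->
  (forall x, U x -> f x = g x) -> affine_regular U f -> affine_regular U g.
Proof.
move=> _ fg + x Ux => /(_ x Ux)[p [q [qx fpq]]]; exists p, q; split=> //.
by move=> y Uy qy; rewrite -fg// fpq.
Qed.

Fact affine_cst (U : set affine) (c : k) :
  open U -> affine_regular U (fun=> c).
Proof.
move=> _ x Ux; exists (mpolyC n c), (mpolyC n 1).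
by rewrite pevalC oner_neq0; split=> // y _ _; rewrite !pevalC divr1.
Qed.

Fact affineD (U : set affine) (f g : affine -> k) : open U ->
  affine_regular U f -> affine_regular U g ->
  affine_regular U (fun x => f x + g x).
Proof.
move=> _ rf rg x Ux.
have [p [q [qx fpq]]] := rf x Ux; have [r [s [sx grs]]] := rg x Ux.
exists (p * s + r * q), (q * s); rewrite pevalM mulf_neq0//; split=> // y Uy.
rewrite pevalD !pevalM mulf_eq0 negb_or => /andP[qy sy].
by rewrite fpq// grs// addf_div.
Qed.

Fact affineM (U : set affine) (f g : affine -> k) : open U ->
  affine_regular U f -> affine_regular U g ->
  affine_regular U (fun x => f x * g x).
Proof.
move=> _ rf rg x Ux.
have [p [q [qx fpq]]] := rf x Ux; have [r [s [sx grs]]] := rg x Ux.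
exists (p * r), (q * s); rewrite pevalM mulf_neq0//; split=> // y Uy.
rewrite !pevalM mulf_eq0 negb_or => /andP[qy sy].
by rewrite fpq// grs// mulf_div.
Qed.

Fact affineS (U V : set affine) (f : affine -> k) :
  open U -> open V -> V `<=` U -> affine_regular U f -> affine_regular V f.
Proof.
move=> _ _ VU rf x Vx; have [p [q [qx fpq]]] := rf x (VU _ Vx).
by exists p, q; split=> // y Vy qy; apply: fpq => //; exact: VU.
Qed.

Fact affine_glue (U : set affine) (f : affine -> k) : open U ->
  (forall x, U x ->
    exists V, [/\ open V, V x, V `<=` U & affine_regular V f]) ->
  affine_regular U f.
Proof.
move=> _ Uf x Ux; have [V [[I VE] Vx VU rf]] := Uf x Ux.
have [p [q [qx fpq]]] := rf x Vx.
have [h Ih hx] : exists2 h, I h & peval h x != 0 by move: Vx; rewrite VE.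
exists (p * h), (q * h); rewrite pevalM mulf_neq0//; split=> // y Uy.
rewrite !pevalM mulf_eq0 negb_or => /andP[qy hy].
rewrite fpq//; last by rewrite VE; exists h.
by rewrite -mulf_div divff// mulr1.
Qed.

HB.instance Definition _ := Topological_isFunctionSpace.Build k affine
  affine_ext affine_cst affineD affineM affineS affine_glue.

End Affine.

Section Product.
Context {k : closedFieldType}.

(* The product of [X] and [Y] as varieties.  It is an alias of [X * Y], since
   its Zariski topology is finer than the product topology. *)
Definition zprod (X Y : fspaceType k) : Type := (X * Y)%type.

Variables X Y : fspaceType k.

HB.instance Definition _ := Choice.on (zprod X Y).

(* The functions on [U * V] that belong to the tensor product of the algebras
   of regular functions on [U] and on [V]. *)
Definition tensor (U : set X) (V : set Y) : set (zprod X Y -> k) :=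
  [set p | exists (n : nat) (f : 'I_n -> X -> k) (g : 'I_n -> Y -> k),
    [/\ forall i, regular U (f i), forall i, regular V (g i) &
        p = fun z => \sum_i f i z.1 * g i z.2]].

(* The principal open sets [p != 0], for [p] as above, form a basis. *)
Definition zprod_open : set (set (zprod X Y)) :=
  [set W | forall z, W z -> exists U V (p : zprod X Y -> k),
    [/\ [/\ open U, open V & tensor U V p], [/\ U z.1, V z.2 & p z != 0] &
        forall w, U w.1 -> V w.2 -> p w != 0 -> W w]].

Lemma tensor_cst U V (c : k) : open U -> open V -> tensor U V (fun=> c).
Proof.
move=> oU oV; exists 1, (fun _ _ => c), (fun _ _ => 1); split=> [i|i|].
- exact: regular_cst.
- exact: regular_cst.
- by apply/funext => z; rewrite big_ord1 mulr1.
Qed.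

Lemma tensorD U V p q :
  tensor U V p -> tensor U V q -> tensor U V (fun z => p z + q z).
Proof.
move=> [m [f [g [rf rg ->]]]] [n [f' [g' [rf' rg' ->]]]].
exists (m + n)%N,
  (fun i => match fintype.split i with inl j => f j | inr j => f' j end),
  (fun i => match fintype.split i with inl j => g j | inr j => g' j end).
split=> [i|i|]; [by case: fintype.split|by case: fintype.split|].
apply/funext => z; rewrite big_split_ord/=.
by congr (_ + _); apply: eq_bigr => i _;
  [rewrite (unsplitK (inl i))|rewrite (unsplitK (inr i))].
Qed.

Lemma tensorM U V p q : open U -> open V ->
  tensor U V p -> tensor U V q -> tensor U V (fun z => p z * q z).
Proof.
move=> oU oV [m [f [g [rf rg ->]]]] [n [f' [g' [rf' rg' ->]]]].
pose e (i : 'I_(#|{: 'I_m * 'I_n}|)) : 'I_m * 'I_n := enum_val i.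
exists #|{: 'I_m * 'I_n}|, (fun i x => f (e i).1 x * f' (e i).2 x),
  (fun i y => g (e i).1 y * g' (e i).2 y).
split=> [i|i|]; [exact: regularM|exact: regularM|].
apply/funext => z; rewrite big_distrlr/= pair_big/=.
rewrite (reindex e)/=; last by exists enum_rank => ? _; [exact: enum_valK|exact: enum_rankK].
by apply: eq_bigr => i _; rewrite mulrACA.
Qed.

Lemma tensorS U V U' V' p : open U -> open V -> open U' -> open V' ->
  U' `<=` U -> V' `<=` V -> tensor U V p -> tensor U' V' p.
Proof.
move=> oU oV oU' oV' sU sV [n [f [g [rf rg ->]]]]; exists n, f, g; split=> // i.
  exact: regularS (rf i).
exact: regularS (rg i).
Qed.

Fact zprod_openT : zprod_open setT.
Proof.
move=> z _; exists setT, setT, (fun=> 1); split=> //; last first.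
  by split=> //; exact: oner_neq0.
by split; [exact: openT|exact: openT|apply: tensor_cst; exact: openT].
Qed.

Fact zprod_openI : setI_closed zprod_open.
Proof.
move=> A B oA oB z [Az Bz].
have [U [V [p [[oU oV tp] [Uz Vz pz] pA]]]] := oA z Az.
have [U' [V' [q [[oU' oV' tq] [U'z V'z qz] qB]]]] := oB z Bz.
have oUU : open (U `&` U') by exact: openI.
have oVV : open (V `&` V') by exact: openI.
exists (U `&` U'), (V `&` V'), (fun w => p w * q w); split.
- split=> //; apply: tensorM => //.
    exact: (tensorS oU oV).
  exact: (tensorS oU' oV').
- by split=> //; rewrite mulf_neq0.
- move=> w [Uw U'w] [Vw V'w]; rewrite mulf_eq0 negb_or => /andP[pw qw].
  by split; [exact: pA|exact: qB].
Qed.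

Fact zprod_open_bigU (I : Type) (f : I -> set (zprod X Y)) :
  (forall i, zprod_open (f i)) -> zprod_open (\bigcup_i f i).
Proof.
move=> of_ z [i _ fz]; have [U [V [p [tp zp pf]]]] := of_ i z fz.
by exists U, V, p; split=> // w Uw Vw pw; exists i => //; exact: pf.
Qed.

HB.instance Definition _ := isOpenTopological.Build (zprod X Y)
  zprod_openT zprod_openI zprod_open_bigU.

Definition zprod_regular (W : set (zprod X Y)) : set (zprod X Y -> k) :=
  [set f | forall z, W z -> exists U V (p q : zprod X Y -> k),
    [/\ [/\ open U, open V, tensor U V p & tensor U V q],
        [/\ U z.1, V z.2 & q z != 0] &
        forall w, W w -> U w.1 -> V w.2 -> q w != 0 -> f w = p w / q w]].

Fact zprod_ext (W : set (zprod X Y)) (f g : zprod X Y -> k) : open W ->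
  (forall x, W x -> f x = g x) -> zprod_regular W f -> zprod_regular W g.
Proof.
move=> _ fg + z Wz => /(_ z Wz)[U [V [p [q [tpq zpq fpq]]]]].
by exists U, V, p, q; split=> // w Ww Uw Vw qw; rewrite -fg// fpq.
Qed.

Fact zprod_cst (W : set (zprod X Y)) (c : k) :
  open W -> zprod_regular W (fun=> c).
Proof.
move=> _ z Wz; exists setT, setT, (fun=> c), (fun=> 1); split.
- by split; try exact: openT; apply: tensor_cst; exact: openT.
- by split=> //; exact: oner_neq0.
- by move=> w _ _ _ _; rewrite divr1.
Qed.

Fact zprodD (W : set (zprod X Y)) (f g : zprod X Y -> k) : open W ->
  zprod_regular W f -> zprod_regular W g ->
  zprod_regular W (fun x => f x + g x).
Proof.
move=> _ rf rg z Wz.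
have [U [V [p [q [[oU oV tp tq] [Uz Vz qz] fpq]]]]] := rf z Wz.
have [U' [V' [r [s [[oU' oV' tr ts] [U'z V'z sz] grs]]]]] := rg z Wz.
have oUU : open (U `&` U') by exact: openI.
have oVV : open (V `&` V') by exact: openI.
have tE h : tensor U V h -> tensor (U `&` U') (V `&` V') h.
  exact: (tensorS oU oV).
have tE' h : tensor U' V' h -> tensor (U `&` U') (V `&` V') h.
  exact: (tensorS oU' oV').
exists (U `&` U'), (V `&` V'), (fun w => p w * s w + r w * q w),
  (fun w => q w * s w); split.
- split=> //; last by apply: tensorM; auto.
  by apply: tensorD; apply: tensorM; auto.
- by split=> //; rewrite mulf_neq0.
- move=> w Ww [Uw U'w] [Vw V'w]; rewrite mulf_eq0 negb_or => /andP[qw sw].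
  by rewrite fpq// grs// addf_div.
Qed.

Fact zprodM (W : set (zprod X Y)) (f g : zprod X Y -> k) : open W ->
  zprod_regular W f -> zprod_regular W g ->
  zprod_regular W (fun x => f x * g x).
Proof.
move=> _ rf rg z Wz.
have [U [V [p [q [[oU oV tp tq] [Uz Vz qz] fpq]]]]] := rf z Wz.
have [U' [V' [r [s [[oU' oV' tr ts] [U'z V'z sz] grs]]]]] := rg z Wz.
have oUU : open (U `&` U') by exact: openI.
have oVV : open (V `&` V') by exact: openI.
have tE h : tensor U V h -> tensor (U `&` U') (V `&` V') h.
  exact: (tensorS oU oV).
have tE' h : tensor U' V' h -> tensor (U `&` U') (V `&` V') h.
  exact: (tensorS oU' oV').
exists (U `&` U'), (V `&` V'), (fun w => p w * r w), (fun w => q w * s w).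
split.
- by split=> //; apply: tensorM; auto.
- by split=> //; rewrite mulf_neq0.
- move=> w Ww [Uw U'w] [Vw V'w]; rewrite mulf_eq0 negb_or => /andP[qw sw].
  by rewrite fpq// grs// mulf_div.
Qed.

Fact zprodS (W W' : set (zprod X Y)) (f : zprod X Y -> k) : open W ->
  open W' -> W' `<=` W -> zprod_regular W f -> zprod_regular W' f.
Proof.
move=> _ _ sW rf z W'z.
have [U [V [p [q [tpq zpq fpq]]]]] := rf z (sW _ W'z).
by exists U, V, p, q; split=> // w W'w; apply: fpq; exact: sW.
Qed.

Fact zprod_glue (W : set (zprod X Y)) (f : zprod X Y -> k) : open W ->
  (forall x, W x ->
    exists W', [/\ open W', W' x, W' `<=` W & zprod_regular W' f]) ->
  zprod_regular W f.
Proof.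
move=> _ Wf z Wz; have [W' [oW' W'z sW rf]] := Wf z Wz.
have [U [V [p [q [[oU oV tp tq] [Uz Vz qz] fpq]]]]] := rf z W'z.
have [U' [V' [h [[oU' oV' th] [U'z V'z hz] hW]]]] := oW' z W'z.
have oUU : open (U `&` U') by exact: openI.
have oVV : open (V `&` V') by exact: openI.
have tE g : tensor U V g -> tensor (U `&` U') (V `&` V') g.
  exact: (tensorS oU oV).
have tE' g : tensor U' V' g -> tensor (U `&` U') (V `&` V') g.
  exact: (tensorS oU' oV').
exists (U `&` U'), (V `&` V'), (fun w => p w * h w), (fun w => q w * h w).
split.
- by split=> //; apply: tensorM; auto.
- by split=> //; rewrite mulf_neq0.
- move=> w Ww [Uw U'w] [Vw V'w]; rewrite mulf_eq0 negb_or => /andP[qw hw].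
  by rewrite fpq//; [rewrite -mulf_div divff// mulr1|exact: hW].
Qed.

HB.instance Definition _ := Topological_isFunctionSpace.Build k (zprod X Y)
  zprod_ext zprod_cst zprodD zprodM zprodS zprod_glue.

End Product.

Section Variety.
Variable k : closedFieldType.

Definition affine_variety (X : fspaceType k) :=
  exists (n : nat) (Z : set (affine k n)),
    closed Z /\ isomorphic X (set_type Z).

Definition is_variety (X : fspaceType k) :=
  (exists (m : nat) (U : 'I_m -> set X),
    [/\ forall i, open (U i), forall i, affine_variety (set_type (U i)) &
        \bigcup_i U i = setT]) /\
  closed [set z : zprod X X | z.1 = z.2].

Record variety := Variety {
  variety_space :> fspaceType k;
  varietyP : is_variety variety_space
}.

End Variety.

HB.mixin Record isAlgGroup (k : closedFieldType) G
    of FunctionSpace k G & Group G := {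
  alg_group_variety : is_variety (G : fspaceType k);
  alg_group_mul : morphism (fun z : zprod G G => (z.1 * z.2)%g : G);
  alg_group_inv : morphism (fun g : G => (g^-1)%g : G)
}.

#[short(type="algGroupType")]
HB.structure Definition AlgGroup (k : closedFieldType) :=
  {G of FunctionSpace k G & Group G & isAlgGroup k G}.

Section Actions.
Context {k : closedFieldType}.

Record alg_action (G : algGroupType k) (X : fspaceType k) := AlgAction {
  alg_act :> G -> X -> X;
  alg_act1 : forall x, alg_act 1%g x = x;
  alg_actM : forall g h x, alg_act (g * h)%g x = alg_act g (alg_act h x);
  alg_act_morphism : morphism (fun z : zprod G X => alg_act z.1 z.2)
}.

Definition alg_subgroup (G : algGroupType k) (H : set G) :=
  [/\ closed H, H 1%g, forall g h, H g -> H h -> H (g * h)%g &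
      forall g, H g -> H (g^-1)%g].

(* A subvariety is a locally closed subset. *)
Definition subvariety (X : fspaceType k) (A : set X) :=
  exists U F : set X, [/\ open U, closed F & A = U `&` F].

(* The notions below only involve the underlying set-theoretic action, and are
   stated for a family of maps [act : G -> X -> X]; this allows restricting
   the action to a subgroup [H] as [act \o set_val : H -> X -> X]. *)

Definition invariant (G X : Type) (act : G -> X -> X) (W : set X) :=
  forall g x, W x -> W (act g x).

Definition restr_act (G X : Type) (act : G -> X -> X) (A : set X)
    (Ainv : invariant act A) (g : G) (a : set_type A) : set_type A :=
  SigSub (mem_set (Ainv g _ (set_valP a))).

Definition gorbit (G X : Type) (act : G -> X -> X) (x : X) : set X :=
  range (act^~ x).

Definition translates (G X : Type) (act : G -> X -> X) (W : set X) : set X :=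
  \bigcup_(w in W) gorbit act w.

Record pseudo_quotient (G : Type) (X : fspaceType k) (act : G -> X -> X)
    (Y : variety k) (p : X -> Y) : Prop := PseudoQuotient {
  pq_morphism : morphism p;
  pq_surj : forall y, exists x, p x = y;
  pq_invariant : forall g x, p (act g x) = p x;
  pq_separated : forall W1 W2 : set X,
    closed W1 -> closed W2 -> invariant act W1 -> invariant act W2 ->
    W1 `&` W2 = set0 -> closure (p @` W1) `&` closure (p @` W2) = set0
}.

Definition orbitwise_closed (G : Type) (X : fspaceType k)
    (act : G -> X -> X) (A : set X) :=
  forall a, A a -> closure (gorbit act a) `<=` A.

Definition closed_in (X : fspaceType k) (A W : set X) :=
  exists2 F, closed F & W = A `&` F.

Record core (G : algGroupType k) (X : fspaceType k) (act : alg_action G X)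
    (Y : set X) (H : set G) : Prop := Core {
  core_subvariety : subvariety Y;
  core_subgroup : alg_subgroup H;
  core_orbitwise_closed :
    orbitwise_closed (act \o set_val : set_type H -> X -> X) Y;
  core_meet : forall x, closure (gorbit act x) `&` Y !=set0;
  core_separated : forall W1 W2 : set X, closed_in Y W1 -> closed_in Y W2 ->
    invariant (act \o set_val : set_type H -> X -> X) W1 ->
    invariant (act \o set_val : set_type H -> X -> X) W2 ->
    W1 `&` W2 = set0 ->
    closure (translates act W1) `&` closure (translates act W2) = set0
}.

Definition saturated (X Y : Type) (p : X -> Y) (U : set X) :=
  p @^-1` (p @` U) = U.

Lemma core_invariant (G : algGroupType k) (X : fspaceType k)
    (act : alg_action G X) (Y : set X) (H : set G) : core act Y H ->
  invariant (act \o set_val : set_type H -> X -> X) Y.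
Proof.
move=> [_ _ oc _ _] h y Yy; apply: (oc y Yy).
by apply: subset_closure; exists h.
Qed.

Lemma saturated_invariant (G : algGroupType k) (X : fspaceType k)
    (act : alg_action G X) (Xbar : variety k) (p : X -> Xbar) (U : set X) :
  pseudo_quotient act p -> saturated p U -> invariant act U.
Proof.
move=> pq sat g x Ux; rewrite -sat/=.
by exists x => //; rewrite (pq_invariant pq).
Qed.

Lemma saturated_invariant_compl (G : algGroupType k) (X : fspaceType k)
    (act : alg_action G X) (Xbar : variety k) (p : X -> Xbar) (Y U : set X) :
  pseudo_quotient act p -> saturated p U ->
  Y `|` U = setT -> Y `&` U = set0 -> invariant act Y.
Proof.
move=> pq sat YUT YU0 g y Yy.
have [//|Ugy] : (Y `|` U) (act g y) by rewrite YUT.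
suff Uy : U y by have : (Y `&` U) y by []; rewrite YU0.
have [u Uu uy] : (p @^-1` (p @` U)) (act g y) by rewrite sat.
by rewrite -sat/=; exists u => //; rewrite uy (pq_invariant pq).
Qed.

End Actions.

Section GrothendieckRing.
Variable k : closedFieldType.

(* The Grothendieck ring: commutative ring expressions in the classes of
   varieties, modulo the congruence generated by the ring axioms and by the
   defining relations.  Subvarieties, products and the point are varieties
   only up to proof, so that the relations are stated for all the varieties
   isomorphic to these spaces. *)
Inductive kexpr : Type :=
| KClass of variety k
| KZero
| KOne
| KOpp of kexpr
| KAdd of kexpr & kexpr
| KMul of kexpr & kexpr.

Inductive keq : kexpr -> kexpr -> Prop :=
| keq_refl a : keq a a
| keq_sym a b : keq a b -> keq b a
| keq_trans b a c : keq a b -> keq b c -> keq a c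
| keq_opp a a' : keq a a' -> keq (KOpp a) (KOpp a')
| keq_add a a' b b' : keq a a' -> keq b b' -> keq (KAdd a b) (KAdd a' b')
| keq_mul a a' b b' : keq a a' -> keq b b' -> keq (KMul a b) (KMul a' b')
| keq_addA a b c : keq (KAdd a (KAdd b c)) (KAdd (KAdd a b) c)
| keq_addC a b : keq (KAdd a b) (KAdd b a)
| keq_add0 a : keq (KAdd KZero a) a
| keq_addN a : keq (KAdd (KOpp a) a) KZero
| keq_mulA a b c : keq (KMul a (KMul b c)) (KMul (KMul a b) c)
| keq_mulC a b : keq (KMul a b) (KMul b a)
| keq_mul1 a : keq (KMul KOne a) a
| keq_mulDl a b c :
    keq (KMul (KAdd a b) c) (KAdd (KMul a c) (KMul b c))
| keq_iso (X Y : variety k) : isomorphic X Y -> keq (KClass X) (KClass Y)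
| keq_scissor (X Y U : variety k) (Z : set X) : closed Z ->
    isomorphic Y (set_type Z) -> isomorphic U (set_type (~` Z)) ->
    keq (KClass X) (KAdd (KClass Y) (KClass U))
| keq_prod (X Y P : variety k) : isomorphic P (zprod X Y) ->
    keq (KClass P) (KMul (KClass X) (KClass Y))
| keq_point (P : variety k) : isomorphic P (affine k 0) ->
    keq (KClass P) KOne.

(* [KVar k] is the quotient of [kexpr] by [keq].  It lives in a universe above
   the one of the carriers of varieties, hence above the one of the carriers of
   mathcomp structures: it cannot be a [comPzRingType], and its ring structure
   is expressed by [KVar_ring_theory]. *)
Definition KVar : Type := {S : kexpr -> Prop | exists a, S = keq a}.

Definition kpi (a : kexpr) : KVar := exist _ (keq a) (ex_intro _ a erefl).

Definition krepr (x : KVar) : kexpr := sval (cid (svalP x)).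

Definition kclass (X : variety k) : KVar := kpi (KClass X).
Definition KVar_zero : KVar := kpi KZero.
Definition KVar_one : KVar := kpi KOne.
Definition KVar_opp (x : KVar) : KVar := kpi (KOpp (krepr x)).
Definition KVar_add (x y : KVar) : KVar := kpi (KAdd (krepr x) (krepr y)).
Definition KVar_mul (x y : KVar) : KVar := kpi (KMul (krepr x) (krepr y)).

Fact KVar_inj (x y : KVar) : sval x = sval y -> x = y.
Proof.
case: x y => [S Sa] [T Tb]/= ST; case: _ / ST in Tb *.
by congr exist; exact: Prop_irrelevance.
Qed.

Lemma kpiP a b : kpi a = kpi b <-> keq a b.
Proof.
split=> [/(congr1 sval)/= ab|ab]; first by rewrite ab; exact: keq_refl.
apply: KVar_inj; apply/funext => c; apply/propext; split.
  by apply: keq_trans; exact: keq_sym.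
exact: keq_trans.
Qed.

Lemma kreprK x : kpi (krepr x) = x.
Proof.
rewrite /krepr; case: cid => a /= xa.
by apply: KVar_inj; rewrite xa.
Qed.

Lemma krepr_kpi a : keq (krepr (kpi a)) a.
Proof. by apply/kpiP; rewrite kreprK. Qed.

Lemma kpi_ind (P : KVar -> Prop) : (forall a, P (kpi a)) -> forall x, P x.
Proof. by move=> Pa x; rewrite -[x]kreprK; exact: Pa. Qed.

Lemma koppE a : KVar_opp (kpi a) = kpi (KOpp a).
Proof. by apply/kpiP/keq_opp; exact: krepr_kpi. Qed.

Lemma kaddE a b : KVar_add (kpi a) (kpi b) = kpi (KAdd a b).
Proof. by apply/kpiP/keq_add; exact: krepr_kpi. Qed.

Lemma kmulE a b : KVar_mul (kpi a) (kpi b) = kpi (KMul a b).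
Proof. by apply/kpiP/keq_mul; exact: krepr_kpi. Qed.

Lemma KVar_ring_theory : Ring_theory.ring_theory KVar_zero KVar_one KVar_add KVar_mul
  (fun x y => KVar_add x (KVar_opp y)) KVar_opp eq.
Proof.
split=> //.
- by elim/kpi_ind=> a; rewrite kaddE; apply/kpiP/keq_add0.
- elim/kpi_ind=> a; elim/kpi_ind=> b.
  by rewrite !kaddE; apply/kpiP/keq_addC.
- elim/kpi_ind=> a; elim/kpi_ind=> b; elim/kpi_ind=> c.
  by rewrite !kaddE; apply/kpiP/keq_addA.
- by elim/kpi_ind=> a; rewrite kmulE; apply/kpiP/keq_mul1.
- elim/kpi_ind=> a; elim/kpi_ind=> b.
  by rewrite !kmulE; apply/kpiP/keq_mulC.
- elim/kpi_ind=> a; elim/kpi_ind=> b; elim/kpi_ind=> c.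
  by rewrite !kmulE; apply/kpiP/keq_mulA.
- elim/kpi_ind=> a; elim/kpi_ind=> b; elim/kpi_ind=> c.
  by rewrite !(kaddE, kmulE); apply/kpiP/keq_mulDl.
- elim/kpi_ind=> a; rewrite koppE kaddE; apply/kpiP.
  by apply: keq_trans (keq_addC _ _) _; exact: keq_addN.
Qed.

End GrothendieckRing.

(* Main.v *)
Require Import Defs.
From HB Require Import structures.
From mathcomp Require Import all_boot all_order all_algebra.
From mathcomp Require Import closed_field.
From mathcomp Require Import all_classical topology.
From mathcomp Require Import -(notations) mpoly.
From mathcomp Require Import zify.

Set Implicit Arguments.
Unset Strict Implicit.
Unset Printing Implicit Defensive.

Import GRing.Theory.

Local Open Scope classical_set_scope.
Local Open Scope ring_scope.

(* Two pseudo-quotients [p : X -> A] and [q : X -> B] separate disjoint closed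
   invariant sets, so they have the same fibres and are topological quotients:
   [A] and [B] are in bijection by a homeomorphism [phi] with [phi \o p = q].
   By noetherian induction it is enough to find, in every nonempty closed subset
   of [A], a nonempty open piece on which [phi] is a morphism; applying this
   to [phi] and to its inverse, the piece is isomorphic to its image and can be
   cut off from both sides.  A coordinate of [phi] is a function [h] on [A] such
   that [h \o p] is regular.  By quantifier elimination over [k] the graph of
   [h] is a finite union of sets given by finitely many equations and
   inequations in [(a, t)], each of which has at most the solution [t = h a].
   Computing with gcds of polynomials in [t], and since [k] has characteristic
   zero, [h a] takes one of finitely many values [r i a / g i a], with [r i] and
   [g i] polynomials.  The loci [h = r i / g i] are closed in [g i != 0] because
   their preimages in [X] are, hence one of them contains a nonempty open
   piece. *)

(** * Piecewise rational families *)

(** A pseudo-quotient has no universal property, so nothing makes [phi] a morphism anywhere in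
    advance. In positive characteristic it may indeed be a morphism nowhere: for the trivial group
    acting on the affine line, the identity and the Frobenius map are both pseudo-quotients, and the
    inverse of Frobenius is regular on no nonempty open set. The cause is multiplicity: elimination
    only yields an equation [c (t - h a)^e = 0], whose coefficients give access to [e h a], and
    recovering [h a] is a division by [e]. As varieties may be reducible and the noetherian
    induction runs through arbitrary closed subsets, no statement speaks of generic points or dense
    open sets: a subset [S] is given and a nonempty relatively open part of it is produced. The
    rational expressions are first chosen point by point, with no structure on the set where each
    one is valid; topology enters only afterwards, through the quotient property of [p]. *)

Section PiecewiseRational.
Variables (k : closedFieldType) (T : Type) (B : set (T -> k)).
Hypothesis B_cst : forall c, B (fun=> c).
Hypothesis B_add : forall f g, B f -> B g -> B (fun a => f a + g a).
Hypothesis B_mul : forall f g, B f -> B g -> B (fun a => f a * g a).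

(* No condition is put on the loci where the various quotients are used: this
   class is stable under arbitrary case distinctions on [a]. *)
Definition pwrat (f : T -> k) := exists (I : finType) (r g : I -> T -> k),
  (forall i, B (r i) /\ B (g i)) /\
  forall a, exists i, g i a != 0 /\ f a = r i a / g i a.

Lemma pwrat_select (I : finType) (F : I -> T -> k) (f : T -> k) :
  (forall i, pwrat (F i)) -> (forall a, exists i, f a = F i a) -> pwrat f.
Proof.
move=> pF fF; pose J i := projT1 (cid (pF i)).
have /(_ _)/cid-/all_sig[r rP] : forall i, exists r : J i -> T -> k,
    exists g : J i -> T -> k, (forall j, B (r j) /\ B (g j)) /\
    forall a, exists j, g j a != 0 /\ F i a = r j a / g j a.
  by move=> i; exact: projT2 (cid (pF i)).
have /(_ _)/cid-/all_sig[g rgP] := rP.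
exists {i : I & J i}, (fun u => r (tag u) (tagged u)),
  (fun u => g (tag u) (tagged u)); split=> [[i j]|a].
  by have [+ _] := rgP i; apply.
have [i ->] := fF a; have [_ /(_ a)[j [gj ->]]] := rgP i.
by exists (existT _ i j).
Qed.

Lemma pwrat_base f : B f -> pwrat f.
Proof.
move=> Bf; exists unit, (fun=> f), (fun=> fun=> 1); split=> // a.
by exists tt; rewrite oner_neq0 divr1.
Qed.

Lemma pwrat_cst c : pwrat (fun=> c).
Proof. exact: pwrat_base. Qed.

Lemma pwratD f g : pwrat f -> pwrat g -> pwrat (fun a => f a + g a).
Proof.
move=> [I [r [s [rs fP]]]] [J [u [v [uv gP]]]].
exists (I * J)%type, (fun i a => r i.1 a * v i.2 a + u i.2 a * s i.1 a),
  (fun i a => s i.1 a * v i.2 a); split=> [[i j]/=|a].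
  by have [? ?] := rs i; have [? ?] := uv j; auto.
have [i [si ->]] := fP a; have [j [vj ->]] := gP a.
by exists (i, j) => /=; rewrite mulf_neq0// addf_div.
Qed.

Lemma pwratM f g : pwrat f -> pwrat g -> pwrat (fun a => f a * g a).
Proof.
move=> [I [r [s [rs fP]]]] [J [u [v [uv gP]]]].
exists (I * J)%type, (fun i a => r i.1 a * u i.2 a),
  (fun i a => s i.1 a * v i.2 a); split=> [[i j]/=|a].
  by have [? ?] := rs i; have [? ?] := uv j; auto.
have [i [si ->]] := fP a; have [j [vj ->]] := gP a.
by exists (i, j) => /=; rewrite mulf_neq0// mulf_div.
Qed.

Lemma pwratN f : pwrat f -> pwrat (fun a => - f a).
Proof.
move=> pf; have := pwratM (pwrat_cst (-1)) pf.
by congr pwrat; apply/funext => a; rewrite mulN1r.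
Qed.

Lemma pwratV f : pwrat f -> pwrat (fun a => (f a)^-1).
Proof.
move=> [I [r [s [rs fP]]]].
(* The index [None] provides the value 0 / 1, which is the inverse where the numerator vanishes, as
   [0^-1 = 0]. *)
exists (option I), (fun i a => if i is Some i then s i a else 0),
  (fun i a => if i is Some i then r i a else 1); split=> [[i|]|a].
- by have [] := rs i.
- by split; exact: B_cst.
- have [i [si ->]] := fP a; have [ri0|ri] := eqVneq (r i a) 0.
    by exists None; rewrite oner_neq0 ri0 mul0r invr0 mul0r.
  by exists (Some i); rewrite invf_div.
Qed.

Lemma pwrat_sum n (F : 'I_n -> T -> k) :
  (forall i, pwrat (F i)) -> pwrat (fun a => \sum_i F i a).
Proof.
elim: n F => [|n IH] F pF.
  by have := pwrat_cst 0; congr pwrat; apply/funext => a; rewrite big_ord0.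
have := pwratD (pF ord0) (IH _ (fun i => pF (lift ord0 i))).
by congr pwrat; apply/funext => a; rewrite big_ord_recl.
Qed.

(** The uniform bound on the size leaves finitely many possibilities for degrees and shifts, which
    keeps leading coefficients and Euclidean division within reach of [pwrat_select]. *)
Definition pwpoly (p : T -> {poly k}) :=
  (exists N, forall a, size (p a) <= N)%N /\
  forall i, pwrat (fun a => (p a)`_i).

Lemma pwpoly_select (I : finType) (P : I -> T -> {poly k}) p :
  (forall i, pwpoly (P i)) -> (forall a, exists i, p a = P i a) -> pwpoly p.
Proof.
move=> pP pE; split=> [|j].
  have /choice[N NP] : forall i, exists N, forall a, (size (P i a) <= N)%N.
    by move=> i; have [] := pP i.
  exists (\max_i N i) => a; have [i ->] := pE a.
  by rewrite (leq_trans (NP i a))// leq_bigmax.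
apply: (@pwrat_select I (fun i a => (P i a)`_j)).
  by move=> i; have [_] := pP i.
by move=> a; have [i ->] := pE a; exists i.
Qed.

Lemma pwpoly_if (c : T -> bool) p q :
  pwpoly p -> pwpoly q -> pwpoly (fun a => if c a then p a else q a).
Proof.
move=> pp pq; apply: (@pwpoly_select bool (fun b => if b then p else q)).
  by case.
by move=> a; exists (c a); case: (c a).
Qed.

Lemma pwpoly_cst p : pwpoly (fun=> p).
Proof. by split=> [|i]; [exists (size p)|exact: pwrat_cst]. Qed.

Lemma pwpolyC f : pwrat f -> pwpoly (fun a => (f a)%:P).
Proof.
move=> pf; split=> [|[|i]]; first by exists 1%N => a; exact: size_polyC_leq1.
  by rewrite (_ : (fun a => _) = f)//; apply/funext => a; rewrite coefC.
rewrite (_ : (fun a => _) = fun=> 0); first exact: pwrat_cst.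
by apply/funext => a; rewrite coefC.
Qed.

Lemma pwpolyD p q : pwpoly p -> pwpoly q -> pwpoly (fun a => p a + q a).
Proof.
move=> [[N Np] pp] [[M Mq] pq]; split=> [|i]; last first.
  rewrite (_ : (fun a => _) = fun a => (p a)`_i + (q a)`_i); first exact: pwratD.
  by apply/funext => a; rewrite coefD.
exists (maxn N M) => a; rewrite (leq_trans (size_polyD _ _))// geq_max.
by rewrite !leq_max Np Mq orbT.
Qed.

Lemma pwpolyM p q : pwpoly p -> pwpoly q -> pwpoly (fun a => p a * q a).
Proof.
move=> [[N Np] pp] [[M Mq] pq]; split=> [|i]; last first.
  rewrite (_ : (fun a => _) =
      fun a => \sum_(j < i.+1) (p a)`_j * (q a)`_(i - j)).
    by apply: pwrat_sum => j; exact: pwratM.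
  by apply/funext => a; rewrite coefM.
exists (N + M)%N => a; rewrite (leq_trans (size_polyMleq _ _))//.
by rewrite (leq_trans (leq_pred _))// leq_add.
Qed.

Lemma pwpolyN p : pwpoly p -> pwpoly (fun a => - p a).
Proof.
move=> pp; have := pwpolyM (pwpoly_cst (-1)) pp.
by congr pwpoly; apply/funext => a; rewrite mulN1r.
Qed.

Lemma pwpolyX p m : pwpoly p -> pwpoly (fun a => p a ^+ m).
Proof.
move=> pp; elim: m => [|m IH]; first exact: pwpoly_cst.
have := pwpolyM pp IH; congr pwpoly; apply/funext => a.
by rewrite exprS.
Qed.

Lemma pwrat_coef p (s : T -> nat) : pwpoly p -> pwrat (fun a => (p a)`_(s a)).
Proof.
move=> [[N Np] pp].
apply: (@pwrat_select 'I_N.+1 (fun i a => (p a)`_i)) => // a.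
(* All coefficients of index at least [N] are 0, so an index beyond [N] can be replaced by [N]. *)
exists (inord (minn (s a) N)); rewrite inordK ?ltnS ?geq_minr//.
by case: leqP => // Ns; rewrite !nth_default// ltnW// (leq_ltn_trans _ Ns).
Qed.

Lemma pwrat_bounded_nat N (s : T -> nat) (f : nat -> k) :
  (forall a, s a <= N)%N -> pwrat (fun a => f (s a)).
Proof.
move=> sN; apply: (@pwrat_select 'I_N.+1 (fun i a => f i)) => [i|a].
  exact: pwrat_cst.
by exists (inord (s a)); rewrite inordK// ltnS.
Qed.

(** Long division, by induction on the size bound of [p]: one step cancels the leading term. The
    tests that steer it vary with [a], which [pwpoly_if] permits. *)
Lemma pwpoly_divmod p q : pwpoly p -> pwpoly q ->
  pwpoly (fun a => p a %/ q a) /\ pwpoly (fun a => p a %% q a).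
Proof.
move=> pp pq; have [[N Np] _] := pp; elim: N => [|N IH] in p pp Np *.
  have p0 a : p a = 0 by apply/eqP; rewrite -size_poly_leq0.
  by split; have := pwpoly_cst 0; congr pwpoly; apply/funext => a;
    rewrite p0 ?div0p ?mod0p.
pose m a := (lead_coef (p a) / lead_coef (q a))%:P *
  'X^(size (p a) - size (q a)).
have pm : pwpoly m.
  apply: pwpolyM; first apply: pwpolyC.
    by apply: pwratM; [exact: pwrat_coef|apply: pwratV; exact: pwrat_coef].
  apply: (@pwpoly_select 'I_N.+2 (fun i a => 'X^i)) => [i|a].
    exact: pwpoly_cst.
  exists (inord (size (p a) - size (q a))); rewrite inordK// ltnS.
  by rewrite (leq_trans (leq_subr _ _)).
(* Here division stops with quotient 0 and remainder [p a]; for [q a = 0] this agrees with [divp0]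
   and [modp0]. *)
pose c a := (size (p a) < size (q a))%N || (q a == 0).
pose p' a := if c a then 0 else p a - m a * q a.
have pp' : pwpoly p'.
  apply: pwpoly_if; first exact: pwpoly_cst.
  by apply: pwpolyD => //; apply: pwpolyN; exact: pwpolyM.
have p'N a : (size (p' a) <= N)%N.
  rewrite /p'; case: ifPn; first by rewrite size_poly0.
  rewrite /c negb_or -leqNgt => /andP[qp q0]; apply/leq_sizeP => j Nj.
  have sq : (0 < size (q a))%N by rewrite size_poly_gt0.
  rewrite coefB /m -mulrA coefCM coefXnM.
  have [jp|jp] := leqP (size (p a)) j.
    have qj : (size (q a) <= j - (size (p a) - size (q a)))%N.
      by rewrite leq_subRL ?(leq_trans (leq_subr _ _))// subnK.
    by rewrite ltnNge (leq_trans (leq_subr _ _) jp)/= !nth_default ?mulr0 ?subrr.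
  have sj : size (p a) = j.+1.
    by apply/eqP; rewrite eqn_leq jp (leq_trans (Np a)).
  have -> : (j < size (p a) - size (q a))%N = false by rewrite sj in qp *; lia.
  have -> : (j - (size (p a) - size (q a)) = (size (q a)).-1)%N.
    by rewrite sj in qp *; lia.
  by rewrite -lead_coefE divfK ?lead_coef_eq0// lead_coefE sj subrr.
have [pd pr] := IH p' pp' p'N.
have pE a : ~~ c a -> p a = m a * q a + p' a.
  by move=> /negPf; rewrite /p' => ->; rewrite addrC subrK.
split.
- have := pwpoly_if c (pwpoly_cst 0) (pwpolyD pm pd).
  congr pwpoly; apply/funext => a; case: ifPn => [|ca].
    by case/orP => [pq'|/eqP->]; [rewrite divp_small|rewrite divp0].
  rewrite [in RHS](pE _ ca) divpD mulpK//.
  by move: ca; rewrite negb_or => /andP[].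
- have := pwpoly_if c pp pr.
  congr pwpoly; apply/funext => a; case: ifPn => [|ca].
    by case/orP => [pq'|/eqP->]; [rewrite modp_small|rewrite modp0].
  by rewrite [in RHS](pE _ ca) modpD modp_mull add0r.
Qed.

Lemma pwpoly_gcd p q : pwpoly p -> pwpoly q ->
  exists2 g, pwpoly g & forall a, g a %= gcdp (p a) (q a).
Proof.
move=> pp pq; have [[N Nq] _] := pq; elim: N => [|N IH] in p q pp pq Nq *.
  exists p => // a; have /eqP-> : q a == 0 by rewrite -size_poly_leq0.
  by rewrite gcdp0 eqpxx.
(* By [modp0] the remainder by 0 is [p a], which would break the size bound of the induction; hence
   the value 0 there. *)
pose r a := if q a == 0 then 0 else p a %% q a.
have pr : pwpoly r.
  apply: pwpoly_if; first exact: pwpoly_cst.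
  by have [] := pwpoly_divmod pp pq.
have rN a : (size (r a) <= N)%N.
  rewrite /r; case: ifPn; first by rewrite size_poly0.
  by move=> q0; rewrite -ltnS (leq_trans _ (Nq a))// ltn_modp.
have [g pg gE] := IH q r pq pr rN.
exists (fun a => if q a == 0 then p a else g a); first exact: pwpoly_if.
move=> a; case: ifPn => [/eqP->|q0]; first by rewrite gcdp0 eqpxx.
apply: eqp_trans (gE a) _; rewrite /r (negPf q0).
apply: eqp_trans (gcdp_modr _ _) _; exact: gcdpC.
Qed.

Lemma pwpoly_common_root (ps : seq (T -> {poly k})) :
  (forall i, (i < size ps)%N -> pwpoly (nth (fun=> 0) ps i)) ->
  exists2 D, pwpoly D & forall a t,
    root (D a) t = all (fun p => root (p a) t) ps.
Proof.
elim: ps => [|p ps IH] pps.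
  (* Every [t] is a root of 0, in accordance with the empty conjunction. *)
  by exists (fun=> 0); [exact: pwpoly_cst|move=> a t; rewrite root0].
have [i ips|D pD DE] := IH; first exact: (pps i.+1).
have [g pg gE] := pwpoly_gcd (pps 0 isT) pD.
by exists g => // a t; rewrite (eqp_root (gE a)) root_gcd DE.
Qed.

End PiecewiseRational.

(* Dividing [D] by its gcd with a large power of [q] removes the roots that [D]
   shares with [q], and leaves a power of ['X - h]. *)
Lemma coprime_part_unique_root (k : closedFieldType) (D q M : {poly k}) h N :
  (size D <= N)%N -> M %= gcdp D (q ^+ N) ->
  (forall t, root D t && ~~ root q t <-> t = h) ->
  exists2 c, c != 0 & exists e, D %/ M = c *: ('X - h%:P) ^+ e.+1.
Proof.
move=> DN ME Dq; have [_ /(_ erefl)/andP[Dh qh]] := Dq h.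
have D0 : D != 0.
  (* If [D] were 0, every nonroot of [q] would equal [h]; but a closed field has a point where
     neither [q] nor ['X - h%:P] vanishes. *)
  apply/eqP => D0; have q0 : q * ('X - h%:P) != 0.
    rewrite mulf_neq0 ?polyXsubC_eq0//.
    by apply: contraNneq qh => ->; rewrite root0.
  have [x] := closed_nonrootP _ q0.
  rewrite rootM root_XsubC negb_or => /andP[qx].
  by case/eqP; apply/Dq; rewrite D0 root0.
have MD : M %| D by rewrite (eqp_dvdl _ ME) dvdp_gcdl.
have DE := divpK MD; set E := D %/ M in DE *.
have E0 : E != 0 by apply: contraNneq D0 => E0; rewrite -DE E0 mul0r.
have Eh : root E h.
  have : root (E * M) h by rewrite DE.
  rewrite rootM (eqp_root ME) root_gcd => /orP[//|/andP[_]].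
  by rewrite {1}/root horner_exp expf_eq0 => /andP[_ qh0]; case/negP: qh.
(* A root [t] other than [h] is a root of [q]. Its multiplicity [m] in [D] is at most [N], so [M]
   contains the whole factor [('X - t%:P) ^+ m] and none of it is left in [E]. *)
have Et t : root E t -> t = h.
  move=> Et; apply: contrapT => /eqP th.
  have Dt : root D t by rewrite -DE rootM Et.
  have qt : root q t.
    by apply: contraNT th => qt; apply/eqP/Dq; rewrite Dt.
  have [m [D1 D1t DE1]] := multiplicity_XsubC D t.
  rewrite D0 /= in D1t.
  have D10 : D1 != 0 by apply: contraNneq D0 => D10; rewrite DE1 D10 mul0r.
  have XM : ('X - t%:P) ^+ m %| M.
    rewrite (eqp_dvdr _ ME) dvdp_gcd; apply/andP; split.
      by rewrite DE1 dvdp_mull.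
    apply: (@dvdp_trans _ (q ^+ m)).
      by apply: dvdp_exp2r; rewrite dvdp_XsubCl.
    apply: dvdp_exp2l; rewrite (leq_trans _ DN)// DE1 size_Mmonic//; last first.
      exact/monic_exp/monicXsubC.
    rewrite size_exp_XsubC addnS /= leq_addl//.
  have [M' ME'] := dvdpP _ _ XM.
  move: DE1; rewrite -DE ME' mulrA => /mulIf E1.
  move: D1t; rewrite -E1 ?rootM ?Et//.
  by rewrite expf_neq0// polyXsubC_eq0.
have [r rE] := closed_field_poly_normal E.
exists (lead_coef E); first by rewrite lead_coef_eq0.
have rh : r = nseq (size r) h.
  apply/all_pred1P/allP => x xr /=; apply/eqP/Et.
  by rewrite rE rootZ ?lead_coef_eq0// root_prod_XsubC.
case: (size r) rh => [|e] rh; last first.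
  by exists e; rewrite {1}rE rh big_nseq iter_mulr_1.
by move: Eh; rewrite rE rh big_nil rootZ ?lead_coef_eq0// (negPf (root1 _)).
Qed.

(** By Vieta the coefficient below the leading one is [- c * (e + 1) * h]; characteristic zero makes
    [e + 1] invertible. *)
Lemma unique_root_coef (k : closedFieldType) (hk : [pchar k] =i pred0)
    (E : {poly k}) c h e : c != 0 -> E = c *: ('X - h%:P) ^+ e.+1 ->
  h = - E`_(size E).-2 / ((size E).-1%:R * E`_(size E).-1).
Proof.
move=> c0 EE.
have sE : size E = e.+2 by rewrite EE size_scale// size_exp_XsubC.
have -> : E`_(size E).-1 = c.
  rewrite -lead_coefE EE lead_coefZ (eqP (monic_exp _ _)) ?mulr1//.
  exact: monicXsubC.
have -> : E`_(size E).-2 = - (c * h *+ e.+1).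
  have := @coefPn_prod_XsubC k (nseq e.+1 h).
  rewrite size_nseq => /(_ isT); rewrite !big_nseq iter_addr_0 iter_mulr_1 => Ee.
  by rewrite sE EE coefZ -mulrnAr -mulrN -Ee.
rewrite opprK sE /= -mulr_natl mulrA mulrAC divff ?mul1r// mulf_neq0//.
by have /pcharf0P-> := hk.
Qed.

Section UniqueRoot.
Variables (k : closedFieldType) (hk : [pchar k] =i pred0).
Variables (T : Type) (B : set (T -> k)).
Hypothesis B_cst : forall c, B (fun=> c).
Hypothesis B_add : forall f g, B f -> B g -> B (fun a => f a + g a).
Hypothesis B_mul : forall f g, B f -> B g -> B (fun a => f a * g a).

(** One exponent [N] serves all [a], because it bounds the size of every [D a]; so a single formula
    gives [h]. It is evaluated at all [a], and takes junk values where the system does not have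
    exactly one solution. *)
Lemma pwrat_unique_root (ps : seq (T -> {poly k})) (q : T -> {poly k}) :
  (forall i, (i < size ps)%N -> pwpoly B (nth (fun=> 0) ps i)) ->
  pwpoly B q ->
  exists2 h, pwrat B h & forall a t0,
    (forall t, all (fun p => root (p a) t) ps && ~~ root (q a) t <-> t = t0) ->
    h a = t0.
Proof.
move=> pps pq; have [D pD DE] := pwpoly_common_root B_cst B_add B_mul pps.
have [[N ND] _] := pD.
have [M pM ME] := pwpoly_gcd B_cst B_add B_mul pD (pwpolyX B_cst B_add B_mul N pq).
have [pE _] := pwpoly_divmod B_cst B_add B_mul pD pM.
set E := fun a => _ in pE.
exists (fun a => - (E a)`_(size (E a)).-2 /
  ((size (E a)).-1%:R * (E a)`_(size (E a)).-1)).
  have [[NE NEP] _] := pE.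
  apply: pwratM => //; first by apply: pwratN => //; exact: pwrat_coef.
  apply: pwratV => //; apply: pwratM => //; last exact: pwrat_coef.
  apply: (pwrat_bounded_nat B_cst (N := NE) (s := fun a => (size (E a)).-1)
    (fun m => m%:R)).
  by move=> a; rewrite (leq_trans (leq_pred _)).
move=> a t0 aP.
have [|c c0 [e Ee]] := coprime_part_unique_root (ND a) (ME a) (h := t0).
  by move=> t; rewrite DE.
by apply/esym; exact: (unique_root_coef hk c0 Ee).
Qed.

End UniqueRoot.

(** * Hilbert's basis theorem *)

(** Dependent choice with access to the whole history. As [Q h n] reads [h] only below [n], the
    sequence can be built from its finite prefixes [s n], padded by [x0]. *)
Lemma dependent_prefix_choice (T : Type) (x0 : T)
    (Q : (nat -> T) -> nat -> T -> Prop) :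
  (forall h n, exists y, Q h n y) ->
  (forall h h' n y, (forall i, (i < n)%N -> h i = h' i) -> Q h n y -> Q h' n y) ->
  exists g : nat -> T, forall n, Q g n (g n).
Proof.
move=> exQ eqQ.
have /choice[F FP] : forall hn : (nat -> T) * nat, exists y, Q hn.1 hn.2 y.
  by move=> [h n]; exact: exQ.
pose s := fix s n := if n is m.+1 then rcons (s m) (F (nth x0 (s m), m)) else [::].
have ss n : size (s n) = n by elim: n => //= n IH; rewrite size_rcons IH.
exists (fun n => F (nth x0 (s n), n)) => n.
apply: (eqQ (nth x0 (s n))); last exact: (FP (_, _)).
elim: n => // n IH i; rewrite ltnS leq_eqVlt /= nth_rcons ss => /predU1P[->|ni].
  by rewrite ltnn eqxx.
by rewrite ni IH.
Qed.

Definition ideal_span (R : comNzRingType) (f : nat -> R) (n : nat) : set R :=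
  [set x | exists c : nat -> R, x = \sum_(i < n) c i * f i].

(** The ascending chain condition in sequential form: it applies directly to sequences built by
    [dependent_prefix_choice], without ideals as objects. *)
Definition noetherian_ring (R : comNzRingType) :=
  forall f : nat -> R, exists n, ideal_span f n (f n).

Section IdealSpan.
Variable R : comNzRingType.
Implicit Types f g : nat -> R.

Lemma ideal_span0 f n : ideal_span f n 0.
Proof. by exists (fun=> 0); rewrite big1// => i _; rewrite mul0r. Qed.

Lemma ideal_spanD f n x y :
  ideal_span f n x -> ideal_span f n y -> ideal_span f n (x + y).
Proof.
move=> [c ->] [d ->]; exists (fun i => c i + d i).
by rewrite -big_split; apply: eq_bigr => i _; rewrite mulrDl.
Qed.

Lemma ideal_spanM f n a x : ideal_span f n x -> ideal_span f n (a * x).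
Proof.
move=> [c ->]; exists (fun i => a * c i).
by rewrite mulr_sumr; apply: eq_bigr => i _; rewrite mulrA.
Qed.

Lemma ideal_span_gen f n i : (i < n)%N -> ideal_span f n (f i).
Proof.
move=> ni; exists (fun j => (j == i)%:R).
rewrite (bigD1 (Ordinal ni))//= eqxx mul1r big1 ?addr0// => j ji.
by rewrite (_ : (j == i :> nat) = false) ?mul0r//; apply: negbTE.
Qed.

Lemma ideal_span_sum f n m (c g : nat -> R) :
  (forall i, (i < m)%N -> ideal_span f n (g i)) ->
  ideal_span f n (\sum_(i < m) c i * g i).
Proof.
move=> fg; elim/big_ind : _ => [|x y|i _].
- exact: ideal_span0.
- exact: ideal_spanD.
- by apply/ideal_spanM/fg.
Qed.

Lemma ideal_span_trans f n g m x :
  (forall i, (i < m)%N -> ideal_span f n (g i)) -> ideal_span g m x ->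
  ideal_span f n x.
Proof. by move=> fg [c ->]; exact: ideal_span_sum. Qed.

Lemma ideal_span_le f n m x : (n <= m)%N ->
  ideal_span f n x -> ideal_span f m x.
Proof.
move=> nm; apply: ideal_span_trans => i ni.
by apply: ideal_span_gen; exact: leq_trans nm.
Qed.

Lemma ideal_span_eq f g n : (forall i, (i < n)%N -> f i = g i) ->
  ideal_span f n = ideal_span g n.
Proof.
move=> fg; apply/seteqP; split=> x [c ->]; exists c; apply: eq_bigr => i _.
  by rewrite fg.
by rewrite -fg.
Qed.

End IdealSpan.

Lemma noetherian_field (k : fieldType) : noetherian_ring k.
Proof.
move=> f; have [f0|f0] := eqVneq (f 0) 0.
  by exists 0; rewrite f0; exact: ideal_span0.
by exists 1, (fun=> f 1 / f 0); rewrite big_ord1 divfK.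
Qed.

Lemma noetherian_surj (R S : comNzRingType) (phi : {rmorphism R -> S}) :
  (forall y, exists x, phi x = y) -> noetherian_ring R -> noetherian_ring S.
Proof.
move=> sphi nR f; have [psi psiK] := choice sphi; have [n [c cE]] := nR (psi \o f).
exists n, (phi \o c); rewrite -[f n]psiK [psi _]cE rmorph_sum; apply: eq_bigr => i _.
by rewrite rmorphM /= psiK.
Qed.

(* The usual proof of Hilbert's basis theorem: choose [g n] of minimal degree
   outside the ideal spanned by the previous ones, and compare leading
   coefficients. *)
Lemma noetherian_poly (R : comNzRingType) :
  noetherian_ring R -> noetherian_ring {poly R}.
Proof.
move=> nR f; apply: contrapT => /forallNP fN.
pose J x := exists n, ideal_span f n x.
have Jspan h n : (forall i, (i < n)%N -> J (h i)) ->
    exists m, forall i, (i < n)%N -> ideal_span f m (h i).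
  elim: n => [|n IH] Jh; first by exists 0.
  have [i|m hm] := IH; first by move=> ?; apply: Jh; exact: ltnW.
  have [m' hm'] := Jh n (ltnSn n); exists (maxn m m') => i.
  rewrite ltnS leq_eqVlt => /predU1P[->|ni].
    by apply: ideal_span_le hm'; exact: leq_maxr.
  by apply: ideal_span_le (hm _ ni); exact: leq_maxl.
(* The premise on the prefix is built into [Q] so that a suitable [y] exists for every [h]; strong
   induction discharges it afterwards in [gP]. *)
pose Q (h : nat -> {poly R}) n y := (forall i, (i < n)%N -> J (h i)) ->
  [/\ J y, ~ ideal_span h n y &
      forall x, J x -> ~ ideal_span h n x -> (size y <= size x)%N].
have [h n|h h' n y hh' + Jh'|g gQ] := @dependent_prefix_choice _ 0 Q.
- have [Jh|nJh] := pselect (forall i, (i < n)%N -> J (h i)); last by exists 0.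
  have [m fm] := Jspan h n Jh.
  pose P d := `[< exists x, [/\ J x, ~ ideal_span h n x & size x = d] >].
  have : exists d, P d.
    exists (size (f m)); apply/asboolP; exists (f m); split=> //.
      by exists m.+1; exact: ideal_span_gen.
    by move=> hm; apply: (fN m); exact: ideal_span_trans hm.
  move=> /ex_minnP[d /asboolP[y [Jy hy <-]] min]; exists y => _; split=> //.
  by move=> x Jx hx; apply: min; apply/asboolP; exists x.
- by rewrite /Q (ideal_span_eq hh'); apply=> i ni; rewrite hh'//; exact: Jh'.
have gP n : [/\ J (g n), ~ ideal_span g n (g n) & forall x, J x ->
    ~ ideal_span g n x -> (size (g n) <= size x)%N].
  by elim/ltn_ind: n => n IH; apply: gQ => i /IH[].
(* The spans increase with [n], so [g n] was already a candidate when [g i] was chosen. *)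
have gmono i n : (i <= n)%N -> (size (g i) <= size (g n))%N.
  move=> ni; have [_ _] := gP i; apply; have [? + _] := gP n => // gn.
  by apply: contra_not gn; exact: ideal_span_le.
have [n [c cE]] := nR (fun n => lead_coef (g n)).
(* The powers of ['X] align the leading terms, and [cE] makes them cancel: [x] is smaller than
   [g n], yet in [J] and outside the span, against the minimality of [g n]. *)
pose x := g n - \sum_(i < n) (c i *: 'X^(size (g n) - size (g i))) * g i.
have spans : ideal_span g n
    (\sum_(i < n) (c i *: 'X^(size (g n) - size (g i))) * g i).
  by exists (fun i => c i *: 'X^(size (g n) - size (g i))).
have [[m Jm] gn gmin] := gP n.
have gn0 : (0 < size (g n))%N.
  rewrite size_poly_gt0; apply: contra_notN gn => /eqP->; exact: ideal_span0.
have : (size (g n) <= size x)%N.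
  apply: gmin.
    have [|m' gm'] := Jspan g n; first by move=> i _; have [] := gP i.
    exists (maxn m m'); apply: ideal_spanD.
      by apply: ideal_span_le Jm; exact: leq_maxl.
    rewrite -mulN1r; apply: ideal_spanM; apply: ideal_span_trans spans => i ni.
    by apply: ideal_span_le (gm' _ ni); exact: leq_maxr.
  move=> gx; apply: gn; rewrite -[g n](subrK (g n - x)).
  by apply: ideal_spanD; rewrite ?subKr// addrC subrK.
apply/negP; rewrite -ltnNge -(prednK gn0) ltnS; apply/leq_sizeP => j jn.
rewrite /x coefB coef_sum.
have E (i : 'I_n) : (c i *: 'X^(size (g n) - size (g i)) * g i)`_j =
    c i * (g i)`_(j - (size (g n) - size (g i))).
  rewrite -scalerAl coefZ coefXnM.
  have gi0 : (0 < size (g i))%N.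
    rewrite size_poly_gt0; have [_ + _] := gP i.
    by move=> gi; apply: contra_notN gi => /eqP->; exact: ideal_span0.
  have -> // : (j < size (g n) - size (g i))%N = false.
  apply/negbTE; rewrite -leqNgt (leq_trans _ jn)//.
  by rewrite -subn1 leq_sub2l.
rewrite (eq_bigr _ (fun i _ => E i)).
move: jn; rewrite leq_eqVlt => /predU1P[<-|jn].
  rewrite -lead_coefE cE; apply/eqP; rewrite subr_eq0; apply/eqP.
  apply: eq_bigr => i _; rewrite lead_coefE; congr (_ * _`_ _).
  have gi := gmono i n (ltnW (ltn_ord i)).
  by rewrite -!subn1 subnAC subKn.
rewrite nth_default; last by rewrite -(prednK gn0).
rewrite big1 ?subr0// => i _; rewrite nth_default ?mulr0//.
have gi := gmono i n (ltnW (ltn_ord i)).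
rewrite (prednK gn0) in jn.
by rewrite leq_subRL ?subnK// (leq_trans (leq_subr _ _)).
Qed.

Section Mpoly.
Variable k : fieldType.

Lemma mpoly_ring_ind n (P : set (mpoly n k)) :
  (forall c, P (mpolyC n c)) -> (forall i, P (mpolyX k (mnm1 i))) ->
  (forall p q, P p -> P q -> P (p + q)) ->
  (forall p q, P p -> P q -> P (p * q)) -> forall p, P p.
Proof.
move=> PC PX PD PM; elim/mpolyind => [|c m p _ _ Pp].
  by rewrite -mpolyC0; exact: PC.
apply: (PD) => //; rewrite -mul_mpolyC; apply: (PM) => //.
rewrite mpolyXE_id; elim/big_ind : _ => [| |i _].
- by rewrite -mpolyC1; exact: PC.
- exact: PM.
- elim: (fun_of_multinom m i) => [|d IH].
    by rewrite expr0 -mpolyC1; exact: PC.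
  by rewrite exprS; exact: (PM).
Qed.

Lemma noetherian_mpoly n : noetherian_ring (mpoly n k).
Proof.
elim: n => [|n IH].
  pose phi : {rmorphism k -> mpoly 0 k} := @mpolyC 0 k.
  apply: (noetherian_surj (phi := phi)) (@noetherian_field k).
  apply: mpoly_ring_ind => [c|[? //]|p q [x xp] [y yq]|p q [x xp] [y yq]].
  - by exists c.
  - by exists (x + y); rewrite rmorphD xp yq.
  - by exists (x * y); rewrite rmorphM xp yq.
(* The indeterminate of [{poly (mpoly n k)}] goes to the last variable; surjectivity of [phi] is
   enough to transfer noetherianity. *)
pose phi := horner_eval (mpolyX k (mnm1 (@ord_max n))) \o
  map_poly (@mwiden n k).
apply: (noetherian_surj (phi := phi)) (noetherian_poly IH).
apply: mpoly_ring_ind => [c|i|p q [x xp] [y yq]|p q [x xp] [y yq]].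
- exists (mpolyC n c)%:P; rewrite /phi /= map_polyC /horner_eval hornerC.
  exact: mwidenC.
- have [<-|/unlift_some[j ij _]] := eqVneq ord_max i.
    by exists 'X; rewrite /phi /= map_polyX /horner_eval hornerX.
  exists (mpolyX k (mnm1 j))%:P; rewrite /phi /= map_polyC /horner_eval hornerC /=.
  rewrite mwidenX mnmwiden1 ij; congr (mpolyX _ (mnm1 _)).
  by apply/val_inj; rewrite /= /bump leqNgt ltn_ord.
- by exists (x + y); rewrite rmorphD xp yq.
- by exists (x * y); rewrite rmorphM xp yq.
Qed.

End Mpoly.

(** * Morphisms on subsets *)

Definition to_set_type (X : Type) (S : set X) (x : X) (Sx : S x) : set_type S :=
  SigSub (mem_set Sx).

Lemma to_set_typeK (X : Type) (S : set X) (x : X) (Sx : S x) :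
  set_val (to_set_type Sx) = x.
Proof. by []. Qed.

Section LocalMorphism.
Variable k : closedFieldType.
Implicit Types X Y Z : fspaceType k.

(** Regularity for the structure induced on [S], but for total functions on the ambient space:
    shrinking [S] then involves no change of type. *)
Definition locreg X (S : set X) (u : X -> k) := forall x, S x ->
  exists (U : set X) (G : X -> k), [/\ open U, U x, regular U G &
    forall y, S y -> U y -> u y = G y].

(* Being a morphism, pointwise: [g = cst] in this definition gives
   continuity. *)
Definition lmorph X Y (S : set X) (f : X -> Y) := forall x, S x ->
  forall (V : set Y) (g : Y -> k), open V -> V (f x) -> regular V g ->
  exists (U : set X) (G : X -> k), [/\ open U, U x, regular U G &
    forall y, S y -> U y -> V (f y) /\ g (f y) = G y].

Lemma lmorph_comp X Y Z (S : set X) (T : set Y) (f : X -> Y) (g : Y -> Z) :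
  lmorph S f -> lmorph T g -> (forall x, S x -> T (f x)) -> lmorph S (g \o f).
Proof.
move=> mf mg ST x Sx V h oV Vx rh.
have [U [G [oU Ux rG UG]]] := mg _ (ST _ Sx) V h oV Vx rh.
have [W [H [oW Wx rH WH]]] := mf _ Sx U G oU Ux rG.
exists W, H; split=> // y Sy Wy; have [Uy <-] := WH y Sy Wy.
exact: UG (ST _ Sy) Uy.
Qed.

Lemma locreg_comp X Y (S : set X) (T : set Y) (f : X -> Y) (u : Y -> k) :
  lmorph S f -> locreg T u -> (forall x, S x -> T (f x)) -> locreg S (u \o f).
Proof.
move=> mf ru ST x Sx; have [U [G [oU Ux rG UG]]] := ru _ (ST _ Sx).
have [W [H [oW Wx rH WH]]] := mf _ Sx U G oU Ux rG.
exists W, H; split=> // y Sy Wy; have [Uy <-] := WH y Sy Wy.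
by rewrite -UG//; exact: ST.
Qed.

Lemma lmorph_sub X Y (S S' : set X) (f : X -> Y) :
  S' `<=` S -> lmorph S f -> lmorph S' f.
Proof.
move=> S'S mf x S'x V g oV Vx rg.
have [U [G [oU Ux rG UG]]] := mf _ (S'S _ S'x) V g oV Vx rg.
by exists U, G; split=> // y /S'S; exact: UG.
Qed.

Lemma locreg_sub X (S S' : set X) u : S' `<=` S -> locreg S u -> locreg S' u.
Proof.
move=> S'S ru x S'x; have [U [G [oU Ux rG UG]]] := ru _ (S'S _ S'x).
by exists U, G; split=> // y /S'S; exact: UG.
Qed.

Lemma lmorph_eq X Y (S : set X) (f g : X -> Y) :
  (forall x, S x -> f x = g x) -> lmorph S f -> lmorph S g.
Proof.
move=> fg mf x Sx V h oV Vx rh.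
have [|U [G [oU Ux rG UG]]] := mf _ Sx V h oV _ rh; first by rewrite fg.
by exists U, G; split=> // y Sy Uy; rewrite -fg//; exact: UG.
Qed.

Lemma locreg_eq X (S : set X) (u v : X -> k) :
  (forall x, S x -> u x = v x) -> locreg S u -> locreg S v.
Proof.
move=> uv ru x Sx; have [U [G [oU Ux rG UG]]] := ru _ Sx.
by exists U, G; split=> // y Sy Uy; rewrite -uv//; exact: UG.
Qed.

Lemma locreg_local X (S : set X) u :
  (forall x, S x -> exists O, [/\ open O, O x & locreg (S `&` O) u]) -> locreg S u.
Proof.
move=> loc x Sx; have [O [oO Ox mf]] := loc _ Sx.
have [U [G [oU Ux rG UG]]] := mf x (conj Sx Ox).
have oUO : open (U `&` O) by exact: openI.
exists (U `&` O), G; split=> //; first exact: regularS rG.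
by move=> y Sy [Uy Oy]; exact: UG.
Qed.

Lemma locreg_cst X (S : set X) c : locreg S (fun=> c).
Proof.
move=> x _; exists setT, (fun=> c); split=> //; first exact: openT.
by apply: regular_cst; exact: openT.
Qed.

Lemma locregD X (S : set X) u v : locreg S u -> locreg S v ->
  locreg S (fun x => u x + v x).
Proof.
move=> ru rv x Sx; have [U [G [oU Ux rG UG]]] := ru _ Sx.
have [V [H [oV Vx rH VH]]] := rv _ Sx.
have oUV : open (U `&` V) by exact: openI.
exists (U `&` V), (fun x => G x + H x); split=> //.
  by apply: regularD => //; [exact: regularS rG|exact: regularS rH].
by move=> y Sy [Uy Vy]; rewrite UG// VH.
Qed.

Lemma locregM X (S : set X) u v : locreg S u -> locreg S v ->
  locreg S (fun x => u x * v x).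
Proof.
move=> ru rv x Sx; have [U [G [oU Ux rG UG]]] := ru _ Sx.
have [V [H [oV Vx rH VH]]] := rv _ Sx.
have oUV : open (U `&` V) by exact: openI.
exists (U `&` V), (fun x => G x * H x); split=> //.
  by apply: regularM => //; [exact: regularS rG|exact: regularS rH].
by move=> y Sy [Uy Vy]; rewrite UG// VH.
Qed.

Lemma regular_locreg X (U : set X) u : open U -> regular U u -> locreg U u.
Proof. by move=> oU ru x Ux; exists U, u. Qed.

Lemma locreg_regular X (U : set X) u : open U -> locreg U u -> regular U u.
Proof.
move=> oU ru; apply: regular_glue => // x Ux.
have [V [G [oV Vx rG VG]]] := ru _ Ux.
have oVU : open (V `&` U) by exact: openI.
exists (V `&` U); split=> //.
apply: (@regular_ext _ _ _ G) => //; last exact: regularS rG.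
by move=> y [Vy Uy]; rewrite VG.
Qed.

Lemma open_local (X : topologicalType) (U : set X) :
  (forall x, U x -> exists O, [/\ open O, O x & O `<=` U]) -> open U.
Proof.
move=> loc; rewrite openE => x Ux; have [O [oO Ox OU]] := loc _ Ux.
by rewrite /interior nbhsE; exists O.
Qed.

Lemma lmorph_open X Y (S : set X) (f : X -> Y) x (V : set Y) : lmorph S f ->
  S x -> open V -> V (f x) ->
  exists O, [/\ open O, O x & forall y, S y -> O y -> V (f y)].
Proof.
move=> mf Sx oV Vx.
have [U [G [oU Ux _ UG]]] := mf x Sx V (fun=> 0) oV Vx (@regular_cst _ _ _ 0 oV).
by exists U; split=> // y Sy Uy; have [] := UG y Sy Uy.
Qed.

Lemma lmorph_openT X Y (f : X -> Y) (O : set X) (V : set Y) : open O ->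
  lmorph O f -> open V -> open (O `&` f @^-1` V).
Proof.
move=> oO mf oV; apply: open_local => x [Ox Vx].
have [U [oU Ux UV]] := lmorph_open mf Ox oV Vx.
exists (U `&` O); split; [exact: openI|by []|].
by move=> y [Uy Oy]; split=> //; exact: UV.
Qed.

Lemma morphismP X Y (f : X -> Y) : morphism f <-> lmorph setT f.
Proof.
split=> [[cf mf] x _ V g oV Vx rg|mf].
  exists (f @^-1` V), (g \o f); split=> //; last exact: mf.
  by move/continuousP: cf; apply.
have cf : continuous f.
  by apply/continuousP => V oV; have := lmorph_openT openT mf oV; rewrite setTI.
split=> // V g oV rg; apply: locreg_regular; first by move/continuousP: cf; apply.
by apply: (locreg_comp (T := V)) (regular_locreg oV rg) _ => //; exact: lmorph_sub mf.
Qed.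

Lemma lmorph_id X (S : set X) : lmorph S id.
Proof. by move=> x Sx V g oV Vx rg; exists V, g. Qed.

Lemma lmorph_set_val X (S : set X) : lmorph setT (set_val : set_type S -> X).
Proof.
move=> x _ V g oV Vx rg; exists (set_val @^-1` V), (g \o set_val); split=> //.
  by exists V.
by move=> a Va; exists V, g.
Qed.

Lemma lmorph_to_set_type X Y (S : set X) (T : set Y) (f : X -> set_type T) :
  lmorph S (set_val \o f) -> lmorph S f.
Proof.
move=> mf x Sx _ g [V oV <-] Vx /(_ _ Vx)[W [F [oW Wx rF gF]]].
have oVW : open (V `&` W) by exact: openI.
have [||U [G [oU Ux rG UG]]] := mf x Sx (V `&` W) F oVW; first by split.
  exact: regularS rF.
exists U, G; split=> // y Sy Uy; have [[Vy Wy] <-] := UG y Sy Uy.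
by split=> //; exact: gF.
Qed.

Lemma lmorph_valP X Y (S : set X) (f : X -> Y) :
  lmorph setT (f \o set_val : set_type S -> Y) <-> lmorph S f.
Proof.
split=> [mf x Sx V g oV Vx rg|mf]; last first.
  apply: lmorph_comp (@lmorph_set_val _ S) mf _ => x _; exact: set_valP.
have [_ [G [[U oU <-] Ux rG UG]]] := mf (to_set_type Sx) I V g oV Vx rg.
have [W [F [oW Wx rF GF]]] := rG _ Ux.
have oUW : open (U `&` W) by exact: openI.
exists (U `&` W), F; split=> //; first exact: regularS rF.
move=> y Sy [Uy Wy]; have [Vy gG] := UG (to_set_type Sy) I Uy.
by split=> //; rewrite -[RHS](GF (to_set_type Sy)).
Qed.

Lemma isomorphic_refl X : isomorphic X X.
Proof. by exists id, id; split=> //; apply/morphismP; exact: lmorph_id. Qed.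

Lemma isomorphic_sym X Y : isomorphic X Y -> isomorphic Y X.
Proof. by move=> [f [g [mf mg fg gf]]]; exists g, f. Qed.

Lemma morphism_comp X Y Z (f : X -> Y) (g : Y -> Z) :
  morphism f -> morphism g -> morphism (g \o f).
Proof.
by move=> /morphismP mf /morphismP mg; apply/morphismP; exact: lmorph_comp mg _.
Qed.

Lemma isomorphic_trans Y X Z : isomorphic X Y -> isomorphic Y Z -> isomorphic X Z.
Proof.
move=> [f [g [mf mg fg gf]]] [f' [g' [mf' mg' fg' gf']]].
exists (f' \o f), (g \o g'); split; [exact: morphism_comp|exact: morphism_comp| |].
  exact: can_comp.
exact: can_comp.
Qed.

Lemma isomorphic_on X Y (S : set X) (T : set Y) (f : X -> Y) (g : Y -> X) :
  lmorph S f -> lmorph T g ->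
  (forall x, S x -> T (f x)) -> (forall y, T y -> S (g y)) ->
  (forall x, S x -> g (f x) = x) -> (forall y, T y -> f (g y) = y) ->
  isomorphic (set_type S) (set_type T).
Proof.
move=> mf mg ST TS gf fg.
exists (fun a => to_set_type (ST _ (set_valP a))),
  (fun b => to_set_type (TS _ (set_valP b))); split.
- by apply/morphismP/lmorph_to_set_type/lmorph_valP.
- by apply/morphismP/lmorph_to_set_type/lmorph_valP.
- by move=> a; apply: val_inj; exact: (gf _ (set_valP a)).
- by move=> b; apply: val_inj; exact: (fg _ (set_valP b)).
Qed.

Lemma isomorphic_set0 X Y :
  isomorphic (set_type (set0 : set X)) (set_type (set0 : set Y)).
Proof.
have e (A : fspaceType k) : set_type (set0 : set A) -> False.
  by move=> a; exact: set_valP a.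
exists (fun a => False_rect _ (e _ a)), (fun b => False_rect _ (e _ b)).
by split=> [| |a|b]; [apply/morphismP => a|apply/morphismP => a| |];
  case: (e _ a) + case: (e _ b).
Qed.

Lemma isomorphic_setT X : isomorphic X (set_type (setT : set X)).
Proof.
exists (fun x => to_set_type (I : setT x)), set_val; split=> //.
- exact/morphismP/lmorph_to_set_type/lmorph_id.
- exact/morphismP/lmorph_set_val.
- by move=> a; exact: val_inj.
Qed.

(** Turning maps between subtypes into total maps takes a value outside [S] and outside [T]. The
    point [x0] supplies both, hence the separate treatment of empty charts in
    [variety_noetherian]. *)
Lemma isomorphic_total X Y (S : set X) (T : set Y) x0 : S x0 ->
  isomorphic (set_type S) (set_type T) ->
  exists (f : X -> Y) (g : Y -> X), [/\ lmorph S f, lmorph T g,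
    forall x, S x -> T (f x) /\ g (f x) = x &
    forall y, T y -> S (g y) /\ f (g y) = y].
Proof.
move=> Sx0 [F [G [/morphismP mF /morphismP mG FG GF]]].
pose f x := if pselect (S x) is left Sx then set_val (F (to_set_type Sx))
  else set_val (F (to_set_type Sx0)).
pose g y := if pselect (T y) is left Ty then set_val (G (to_set_type Ty))
  else x0.
have fE a : f (set_val a) = set_val (F a).
  rewrite /f; case: pselect => [Sa|[]]; last exact: set_valP.
  by congr (set_val (F _)); exact: val_inj.
have gE b : g (set_val b) = set_val (G b).
  rewrite /g; case: pselect => [Sa|[]]; last exact: set_valP.
  by congr (set_val (G _)); exact: val_inj.
exists f, g; split.
- apply/lmorph_valP; apply: lmorph_eq (lmorph_comp mF (@lmorph_set_val _ T) _) => //.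
  by move=> a _; rewrite /= fE.
- apply/lmorph_valP; apply: lmorph_eq (lmorph_comp mG (@lmorph_set_val _ S) _) => //.
  by move=> a _; rewrite /= gE.
- move=> x Sx; rewrite -(to_set_typeK Sx) fE gE FG.
  by split=> //; exact: set_valP.
- move=> y Ty; rewrite -(to_set_typeK Ty) gE fE GF.
  by split=> //; exact: set_valP.
Qed.

Lemma isomorphic_set_type X (S : set X) (A : set (set_type S)) (A' : set X) :
  (forall a, A a <-> A' (set_val a)) -> A' `<=` S ->
  isomorphic (set_type A) (set_type A').
Proof.
move=> AA' A'S.
have A'A x (A'x : A' x) : A (to_set_type (A'S _ A'x)) by apply/AA'.
exists (fun a => to_set_type ((AA' _).1 (set_valP a))),
  (fun b => to_set_type (A'A _ (set_valP b))); split.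
- apply/morphismP/lmorph_to_set_type.
  by apply: lmorph_comp (@lmorph_set_val _ A) (@lmorph_set_val _ S) _.
- by apply/morphismP/lmorph_to_set_type/lmorph_to_set_type/lmorph_set_val.
- by move=> a; apply/val_inj/val_inj.
- by move=> b; apply/val_inj.
Qed.

End LocalMorphism.

(** * Affine charts *)

Section AffineSpace.
Variables (k : closedFieldType) (n : nat).
Implicit Types (S : set (affine k n)) (p q g : mpoly n k).

Lemma peval_X i (x : affine k n) : peval (mpolyX k (mnm1 i)) x = (x : 'rV[k]_n) ord0 i.
Proof. exact: mevalXU. Qed.

Lemma open_peval_neq0 g : open [set x : affine k n | peval g x != 0].
Proof.
exists [set g]; apply/seteqP; split=> [x gx|x [p ->]]//.
by exists g.
Qed.

Lemma affine_open_basis (O : set (affine k n)) x : open O -> O x ->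
  exists2 g, peval g x != 0 & forall y, peval g y != 0 -> O y.
Proof.
move=> [I ->] [g Ig gx]; exists g => // y gy.
by exists g.
Qed.

Lemma locreg_affine_frac p q S : (forall x, S x -> peval q x != 0) ->
  locreg S (fun x => peval p x / peval q x).
Proof.
move=> q0 x Sx; exists [set x | peval q x != 0],
  (fun x => peval p x / peval q x); split=> //.
- exact: open_peval_neq0.
- exact: q0.
- by move=> y qy; exists p, q.
Qed.

Lemma locreg_peval p S : locreg S (peval p).
Proof.
apply: locreg_eq (@locreg_affine_frac p (mpolyC n 1) S _) => x _.
  by rewrite pevalC divr1.
by rewrite pevalC oner_neq0.
Qed.

Lemma locreg_affineP S u x : locreg S u -> S x -> exists p q, peval q x != 0 /\
  forall y, S y -> peval q y != 0 -> u y = peval p y / peval q y.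
Proof.
move=> ru Sx; have [U [G [oU Ux rG UG]]] := ru x Sx.
have [p [q [qx Gpq]]] := rG x Ux.
have [g gx gU] := affine_open_basis oU Ux.
exists (p * g), (q * g); rewrite pevalM mulf_neq0//; split=> // y Sy.
rewrite !pevalM mulf_eq0 negb_or => /andP[qy gy].
by rewrite UG ?Gpq//; [rewrite -mulf_div divff// mulr1|exact: gU|exact: gU].
Qed.

End AffineSpace.

Section Charts.
Variable k : closedFieldType.
Implicit Types X Y : fspaceType k.

Record chart X n (U : set X) (Z : set (affine k n)) (a : X -> affine k n)
    (a' : affine k n -> X) : Prop := Chart {
  chart_dom_open : open U;
  chart_im_closed : closed Z;
  chart_lmorph : lmorph U a;
  chart_inv_lmorph : lmorph Z a';
  chart_im : forall x, U x -> Z (a x);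
  chart_dom : forall z, Z z -> U (a' z);
  chartK : forall x, U x -> a' (a x) = x;
  chart_invK : forall z, Z z -> a (a' z) = z
}.

Definition locally_affine X := forall x : X,
  exists n U Z (a : X -> affine k n) a', U x /\ chart U Z a a'.

Lemma variety_locally_affine X : is_variety X -> locally_affine X.
Proof.
move=> [[m [U [oU aU UT]]] _] x.
have [i _ Ux] : (\bigcup_i U i) x by rewrite UT.
have [n [Z [cZ iso]]] := aU i.
have [a [a' [ma ma' aP aP']]] := isomorphic_total Ux iso.
exists n, (U i), Z, a, a'; split=> //; split=> //.
- by move=> y /aP[].
- by move=> y /aP'[].
- by move=> y /aP[].
- by move=> y /aP'[].
Qed.

Lemma affine_locally_affine n : locally_affine (affine k n).
Proof.
move=> x; exists n, setT, setT, id, id; split=> //; split=> //.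
- exact: openT.
- exact: lmorph_id.
- exact: lmorph_id.
Qed.

Section ChartTheory.
Variables (X : fspaceType k) (n : nat) (U : set X) (Z : set (affine k n)).
Variables (a : X -> affine k n) (a' : affine k n -> X).
Hypothesis ch : chart U Z a a'.

Lemma chart_basis (O : set X) x : open O -> O x -> U x ->
  exists2 g, peval g (a x) != 0 & forall y, U y -> peval g (a y) != 0 -> O y.
Proof.
move=> oO Ox Ux; have Zx := chart_im ch Ux.
have [|O' [oO' O'x O'O]] := lmorph_open (chart_inv_lmorph ch) Zx oO.
  by rewrite (chartK ch).
have [g gx gO'] := affine_open_basis oO' O'x.
exists g => // y Uy gy; rewrite -(chartK ch Uy); apply: O'O.
  exact: chart_im ch _ Uy.
exact: gO'.
Qed.

Lemma chart_open g : open [set y | U y /\ peval g (a y) != 0].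
Proof.
exact: (lmorph_openT (chart_dom_open ch) (chart_lmorph ch) (open_peval_neq0 g)).
Qed.

Lemma chart_locregP (S : set X) u x : locreg S u -> S x -> U x ->
  exists p q, peval q (a x) != 0 /\ forall y, S y -> U y ->
    peval q (a y) != 0 -> u y = peval p (a y) / peval q (a y).
Proof.
move=> ru Sx Ux; pose S' := [set z | Z z /\ S (a' z)].
have ru' : locreg S' (u \o a').
  apply: (locreg_comp (T := S)) => //; last by move=> ? [].
  by apply: lmorph_sub (chart_inv_lmorph ch) => ? [].
have [|p [q [qx upq]]] := locreg_affineP ru' (x := a x).
  by split; [exact: chart_im ch _ Ux|rewrite (chartK ch)].
exists p, q; split=> // y Sy Uy qy; rewrite -upq//= ?(chartK ch)//.
by split; [exact: chart_im ch _ Uy|rewrite (chartK ch)].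
Qed.

Lemma chart_frac_locreg p q (S : set X) :
  (forall y, S y -> U y /\ peval q (a y) != 0) ->
  locreg S (fun y => peval p (a y) / peval q (a y)).
Proof.
move=> Sq; have := @locreg_affine_frac k n p q [set z | peval q z != 0] (fun _ => id).
move=> /(locreg_comp (S := S) (f := a)); apply; last by move=> y /Sq[].
by apply: lmorph_sub (chart_lmorph ch) => y /Sq[].
Qed.

End ChartTheory.

(** The axioms of [fspaceType] do not mention inverses. They come from charts, where [u] is locally
    a fraction that can be turned over. *)
Lemma locregV X (S : set X) u : locally_affine X -> locreg S u ->
  (forall x, S x -> u x != 0) -> locreg S (fun x => (u x)^-1).
Proof.
move=> lX ru u0; apply: locreg_local => x Sx.
have [n [U [Z [a [a' [Ux ch]]]]]] := lX x.
have [p [q [qx upq]]] := chart_locregP ch ru Sx Ux.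
exists [set y | U y /\ peval q (a y) != 0]; split=> //.
  exact: chart_open ch _.
apply: (@locreg_eq _ _ _ (fun y => peval q (a y) / peval p (a y))).
  by move=> y [Sy [Uy qy]]; rewrite upq// invf_div.
apply: (chart_frac_locreg ch) => y [Sy [Uy qy]]; split=> //.
by have := u0 y Sy; rewrite upq// mulf_eq0 negb_or => /andP[].
Qed.

Lemma locreg_open_neq0 X (O : set X) u : locally_affine X -> open O ->
  locreg O u -> open [set x | O x /\ u x != 0].
Proof.
move=> lX oO ru; apply: open_local => x [Ox ux].
have [n [U [Z [a [a' [Ux ch]]]]]] := lX x.
have [p [q [qx upq]]] := chart_locregP ch ru Ox Ux.
exists (O `&` [set y | U y /\ peval (q * p) (a y) != 0]); split.
- by apply: openI => //; exact: chart_open ch _.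
- split=> //; split=> //; rewrite pevalM mulf_neq0//.
  by move: ux; rewrite upq// mulf_eq0 negb_or => /andP[].
- move=> y [Oy [Uy]]; rewrite pevalM mulf_eq0 negb_or => /andP[qy py].
  by split=> //=; rewrite upq// mulf_neq0// invr_eq0.
Qed.

Lemma locreg_peval_comp X n (S : set X) (f : X -> affine k n) p :
  (forall i, locreg S (fun x => (f x : 'rV[k]_n) ord0 i)) ->
  locreg S (fun x => peval p (f x)).
Proof.
move=> rf; move: p; apply: mpoly_ring_ind => [c|i|p q rp rq|p q rp rq] /=.
- by apply: locreg_eq (@locreg_cst k X S c) => x _; rewrite pevalC.
- by apply: locreg_eq (rf i) => x _; rewrite peval_X.
- by apply: locreg_eq (locregD rp rq) => x _; rewrite pevalD.
- by apply: locreg_eq (locregM rp rq) => x _; rewrite pevalM.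
Qed.

Lemma lmorph_affine X n (S : set X) (f : X -> affine k n) : locally_affine X ->
  (forall i, locreg S (fun x => (f x : 'rV[k]_n) ord0 i)) -> lmorph S f.
Proof.
move=> lX rf x Sx V g oV Vx rg.
have [p [q [qx gpq]]] := rg (f x) Vx.
have [h hx hV] := affine_open_basis oV Vx.
have rfp e := locreg_peval_comp e rf.
(* [G] extends [h * q] composed with [f]. Its nonvanishing locus is open in [X], and [f] maps the
   part of it in [S] into [V] and into the domain of [p / q]. *)
have [U [G [oU Ux rG UG]]] := rfp (h * q) x Sx.
have ne0 y : S y -> U y -> G y != 0 -> peval h (f y) != 0 /\ peval q (f y) != 0.
  move=> Sy Uy; rewrite -UG// pevalM mulf_eq0 negb_or => /andP[].
  by [].
have oW := locreg_open_neq0 lX oU (regular_locreg oU rG).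
have [W [H [oW' Wx rH WH]]] : exists W H, [/\ open W, W x, regular W H &
    forall y, [set y | S y /\ peval q (f y) != 0] y -> W y ->
    peval p (f y) / peval q (f y) = H y].
  suff : locreg [set y | S y /\ peval q (f y) != 0]
    (fun y => peval p (f y) / peval q (f y)) by apply; split.
  apply: locregM; first by apply: locreg_sub (rfp p) => ? [].
  apply: locregV => //; last by move=> ? [].
  by apply: locreg_sub (rfp q) => ? [].
exists (W `&` [set x | U x /\ G x != 0]), H; split.
- exact: openI.
- by split=> //; split=> //; rewrite -UG// pevalM mulf_neq0.
- by apply: regularS rH => //; exact: openI.
- move=> y Sy [Wy [Uy Gy]]; have [hy qy] := ne0 y Sy Uy Gy.
  by split; [exact: hV|rewrite gpq ?WH//; exact: hV].
Qed.

Lemma closed_lmorph_preimage X Y (Z : set X) (f : X -> Y) (F : set Y) :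
  closed Z -> lmorph Z f -> closed F -> closed [set z | Z z /\ F (f z)].
Proof.
move=> cZ mf cF; rewrite -openC; apply: open_local => z ZFz.
have [Zz|nZz] := pselect (Z z).
  have nFz : (~` F) (f z) by move=> Fz; exact: ZFz.
  have [O [oO Oz OF]] := lmorph_open mf Zz (closed_openC cF) nFz.
  exists O; split=> // y Oy [Zy Fy]; exact: OF Zy Oy Fy.
exists (~` Z); split=> //; first exact: closed_openC.
by move=> y nZy [].
Qed.

Lemma affine_variety_iso X Y : isomorphic X Y -> affine_variety X ->
  affine_variety Y.
Proof.
move=> iso [n [Z [cZ isoZ]]]; exists n, Z; split=> //.
exact: isomorphic_trans (isomorphic_sym iso) isoZ.
Qed.

(* The Rabinowitsch trick: [g != 0] on [F] is the closed set [g(x) t = 1] of the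
   affine space with one more coordinate. *)
Lemma affine_variety_principal n (F : set (affine k n)) g : closed F ->
  affine_variety (set_type (F `&` [set z | peval g z != 0])).
Proof.
move=> cF.
pose e (z : affine k n) : affine k n.+1 := \row_(j < n.+1)
  if unlift ord_max j is Some i then (z : 'rV[k]_n) ord0 i else (peval g z)^-1.
pose r (w : affine k n.+1) : affine k n :=
  \row_i (w : 'rV[k]_n.+1) ord0 (lift ord_max i).
pose l (w : affine k n.+1) := (w : 'rV[k]_n.+1) ord0 ord_max.
have rl : locreg setT l.
  by apply: locreg_eq (@locreg_peval k n.+1 (mpolyX k (mnm1 ord_max)) setT) => w _;
    rewrite peval_X.
have mr : lmorph setT r.
  apply: lmorph_affine; first exact: affine_locally_affine.
  move=> i; pose Xi := mpolyX k (mnm1 (lift (@ord_max n) i)).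
  apply: locreg_eq (@locreg_peval k n.+1 Xi setT) => w _.
  by rewrite peval_X mxE.
pose W := [set w | F (r w) /\ peval g (r w) * l w = 1].
have er z : r (e z) = z.
  by apply/rowP => i; rewrite !mxE liftK.
have el z : l (e z) = (peval g z)^-1.
  by rewrite /l mxE unlift_none.
exists n.+1, W; split.
  have -> : W = [set w | setT w /\ F (r w)] `&`
      ~` [set w | setT w /\ peval g (r w) * l w + (- 1) != 0].
    apply/seteqP; split=> w [].
      by move=> Fw gw; split=> // -[_]; rewrite gw subrr eqxx.
    move=> [_ Fw] gw; split=> //; apply/eqP; rewrite -subr_eq0.
    by apply: contraPT gw => gw; apply.
  apply: closedI; first exact: closed_lmorph_preimage closedT mr cF.
  apply: open_closedC; apply: locreg_open_neq0.
  - exact: affine_locally_affine.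
  - exact: openT.
  apply: locregD; last exact: locreg_cst.
  by apply: locregM => //; apply: locreg_comp mr (@locreg_peval k n g setT) _.
apply: (isomorphic_on (f := e) (g := r)).
- apply: lmorph_affine; first exact: affine_locally_affine.
  move=> j; case: (unliftP ord_max j) => [i|] ->.
    apply: locreg_eq (@locreg_peval k n (mpolyX k (mnm1 i)) _) => w _.
    by rewrite peval_X mxE liftK.
  apply: (@locreg_eq _ _ _ (fun z => (peval g z)^-1)).
    by move=> z _; rewrite mxE unlift_none.
  apply: locregV; [exact: affine_locally_affine|exact: locreg_peval|].
  by move=> z [].
- exact: lmorph_sub mr.
- by move=> z [Fz gz]; rewrite /W /= er el divff.
- move=> w [Fw gw]; split=> //=; apply/eqP => g0.
  by move/eqP: gw; rewrite g0 mul0r eq_sym oner_eq0.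
- by move=> z _; exact: er.
- move=> w [Fw gw]; apply/rowP => j; rewrite mxE.
  case: (unliftP ord_max j) => [i|] ->; first by rewrite mxE.
  have g0 : peval g (r w) != 0.
    by apply/eqP => g0; move/eqP: gw; rewrite g0 mul0r eq_sym oner_eq0.
  by apply: (mulfI g0); rewrite mulfV// gw.
Qed.

(** In a chart, the open part of [S] contains a principal open neighbourhood of [s] and the closed
    part becomes closed in affine space, so that [affine_variety_principal] applies. *)
Lemma subvariety_locally_affine X (S : set X) s : locally_affine X ->
  subvariety S -> S s ->
  exists O, [/\ open O, O s & affine_variety (set_type (S `&` O))].
Proof.
move=> lX [V [F [oV cF ->]]] [Vs Fs].
have [n [U [Z [a [a' [Us ch]]]]]] := lX s.
have [g gs gV] := chart_basis ch oV Vs Us.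
exists [set y | U y /\ peval g (a y) != 0]; split=> //.
  exact: chart_open ch _.
have cF' := closed_lmorph_preimage (chart_im_closed ch) (chart_inv_lmorph ch) cF.
apply: affine_variety_iso (affine_variety_principal g cF').
apply: isomorphic_sym; apply: (isomorphic_on (f := a) (g := a')).
- by apply: lmorph_sub (chart_lmorph ch) => y [_ []].
- by apply: lmorph_sub (chart_inv_lmorph ch) => y [[]].
- move=> y [[Vy Fy] [Uy gy]]; split=> //; split; first exact: chart_im ch _ Uy.
  by rewrite (chartK ch).
- move=> z [[Zz Fz] gz]; have Uz := chart_dom ch Zz.
  have az := chart_invK ch Zz.
  by split; split=> //; rewrite ?az//; apply: gV; rewrite ?az.
- by move=> y [_ [Uy _]]; exact: chartK ch _ Uy.
- by move=> z [[Zz _] _]; exact: chart_invK ch _ Zz.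
Qed.

End Charts.

(** * Noetherian spaces and subvarieties *)

Section Noetherian.
Variable k : closedFieldType.

(** Quasi-compactness of every open part of [S], since [F] is not asked to cover [S]; this amounts
    to the descending chain condition on closed sets. *)
Definition noetherian_on (X : topologicalType) (S : set X) :=
  forall F : set (set X), (forall O, F O -> open O) ->
  exists (I : finType) (f : I -> set X), (forall i, F (f i)) /\
    forall x O, S x -> F O -> O x -> exists i, f i x.

(** Otherwise one can choose principal open sets inside members of [F], each containing a point
    where all earlier equations vanish. By Hilbert's theorem some equation is a combination of the
    earlier ones, so it vanishes at that point too. *)
Lemma noetherian_affine n : noetherian_on (setT : set (affine k n)).
Proof.
move=> F oF; apply: contrapT => nF.
pose Q (h : nat -> mpoly n k) m g := (exists2 O, F O & forall y, peval g y != 0 -> O y) /\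
  exists2 x, peval g x != 0 & forall i, (i < m)%N -> peval (h i) x = 0.
have [h m|h h' m g hh'|g gP] := @dependent_prefix_choice _ 0
    (fun h m g => (forall i, (i < m)%N ->
       exists2 O, F O & forall y, peval (h i) y != 0 -> O y) -> Q h m g).
- have [hF|nhF] := pselect (forall i, (i < m)%N ->
       exists2 O, F O & forall y, peval (h i) y != 0 -> O y); last by exists 0.
  apply: contrapT => /forallNP noQ; apply: nF.
  have /choice[f fP] : forall i : 'I_m, exists O,
      F O /\ forall y, peval (h i) y != 0 -> O y.
    by move=> i; have [O FO hO] := hF i (ltn_ord i); exists O.
  exists 'I_m, f; split=> [i|x O _ FO Ox]; first by have [] := fP i.
  have [g gx gO] := affine_open_basis (oF _ FO) Ox.
  apply: contrapT => /forallNP nf; apply: (noQ g) => _; split; first by exists O.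
  exists x => // i im; apply/eqP; apply: contrapT => /negP hi.
  by apply: (nf (Ordinal im)); have [_] := fP (Ordinal im); apply.
- move=> Qg h'F; have [|[O FO gO] [x gx hx]] := Qg.
    by move=> i im; rewrite hh'//; exact: h'F.
  split; first by exists O.
  by exists x => // i im; rewrite -hh'// hx.
have gF m : exists2 O, F O & forall y, peval (g m) y != 0 -> O y.
  elim/ltn_ind: m => m IH; have [|] := gP m; first exact: IH.
  by [].
have [m [c gE]] := @noetherian_mpoly k n g.
have [_ [x gx g0]] := gP m (fun i _ => gF i).
suff g0' : peval (g m) x = 0 by rewrite g0' eqxx in gx.
rewrite gE; elim/big_ind : _ => [|p q p0 q0|i _].
- exact: meval0.
- by rewrite pevalD p0 q0 addr0.
- by rewrite pevalM g0 ?mulr0.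
Qed.

Lemma variety_noetherian (X : fspaceType k) : is_variety X ->
  noetherian_on (setT : set X).
Proof.
move=> [[m [U [oU aU UT]]] _] F oF.
have UF i : exists (I : finType) (f : I -> set X), (forall i, F (f i)) /\
    forall x O, U i x -> F O -> O x -> exists i, f i x.
  have [[x0 Ux0]|U0] := pselect (exists x, U i x); last first.
    by exists void, (fun=> setT); split=> // x O Ux; case: U0; exists x.
  have [n [Z [cZ iso]]] := aU i.
  have [a [a' [ma ma' aP aP']]] := isomorphic_total Ux0 iso.
  (* The family is transported to affine space through traces on [Z], so that [noetherian_affine]
     applies to it. *)
  pose F' := [set O' : set (affine k n) | open O' /\
    exists2 O, F O & forall z, Z z -> O' z -> O (a' z)].
  have [|K [f [fF' fP]]] := @noetherian_affine n F'; first by move=> ? [].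
  have /choice[f' f'P] : forall j, exists O, F O /\
      forall z, Z z -> f j z -> O (a' z).
    by move=> j; have [_ [O FO OP]] := fF' j; exists O.
  exists K, f'; split=> [j|x O Ux FO Ox]; first by have [] := f'P j.
  have [Zx ax] := aP x Ux.
  have [|O' [oO' O'x O'O]] := lmorph_open ma' Zx (oF _ FO); first by rewrite ax.
  have [||j fj] := fP (a x) O' I => //; first by split=> //; exists O.
  by exists j; rewrite -ax; have [_] := f'P j; apply.
pose J i := projT1 (cid (UF i)).
have /(_ _)/cid-/all_sig[f fP] : forall i, exists f : J i -> set X,
    (forall i, F (f i)) /\ forall x O, U i x -> F O -> O x -> exists i, f i x.
  by move=> i; exact: projT2 (cid (UF i)).
exists {i : 'I_m & J i}, (fun u => f (tag u) (tagged u)); split=> [[i j]|x O _ FO Ox].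
  by have [+ _] := fP i; apply.
have [i _ Ux] : (\bigcup_i U i) x by rewrite UT.
have [_ /(_ x O Ux FO Ox)[j fj]] := fP i.
by exists (existT _ i j).
Qed.

(** A counterexample would contain a strictly smaller one, and so on; finitely many complements in
    this chain have the same union as all of them, so the chain stops. *)
Lemma noetherian_closed_ind (X : topologicalType) (P : set X -> Prop) :
  noetherian_on (setT : set X) ->
  (forall Z, closed Z ->
    (forall Z', closed Z' -> Z' `<=` Z -> Z' != Z -> P Z') -> P Z) ->
  forall Z, closed Z -> P Z.
Proof.
move=> nX IH Z cZ; apply: contrapT => nPZ.
pose bad := {Z | closed Z /\ ~ P Z}.
have /choice[F FP] : forall b : bad, exists b' : bad,
    sval b' `<=` sval b /\ sval b' != sval b.
  move=> [Y [cY nPY]]; apply: contrapT => /forallNP nb; apply: (nPY).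
  apply: IH => // Z' cZ' Z'Y Z'neY; apply: contrapT => nPZ'.
  exact: (nb (exist _ Z' (conj cZ' nPZ'))).
pose s n := sval (iter n F (exist _ Z (conj cZ nPZ))).
have cs n : closed (s n) by rewrite /s; case: (iter _ _ _) => ? [].
have ss n m : (n <= m)%N -> s m `<=` s n.
  move=> /subnK<-; elim: (m - n)%N => [|d IHd]; first by [].
  apply: subset_trans IHd; rewrite addSn.
  by have [] := FP (iter (d + n) F (exist _ Z (conj cZ nPZ))).
have [|K [f [fO fP]]] := nX [set O | exists n, O = ~` s n].
  by move=> _ [n ->]; exact: closed_openC.
have {fO}[N fN] := choice fO.
pose M := \max_i N i.
have [sM] := FP (iter M F (exist _ Z (conj cZ nPZ))).
case/eqP; apply/seteqP; split=> // x sx; apply: contrapT => nsx.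
have [i fi] := fP x (~` s M.+1) I (ex_intro _ M.+1 erefl) nsx.
move: fi; rewrite fN; apply; apply: (ss _ M) sx.
exact: leq_bigmax.
Qed.

(** Serves to pull back the complement of the diagonal, so that subvarieties inherit separatedness.
    Composing the factors of a tensor with [f] and [g] gives a tensor again. *)
Lemma zprod_map_open (X Y X' Y' : fspaceType k) (f : X -> X') (g : Y -> Y')
    (W : set (zprod X' Y')) : morphism f -> morphism g -> open W ->
  open [set z : zprod X Y | W (f z.1, g z.2)].
Proof.
move=> [cf mf] [cg mg] oW.
suff : zprod_open [set z : zprod X Y | W (f z.1, g z.2)] by [].
move=> z Wz.
have [U [V [p [[oU oV [n [u [v [ru rv pE]]]]] [Uz Vz pz] pW]]]] := oW _ Wz.
have oU' : open (f @^-1` U) by move/continuousP: cf; apply.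
have oV' : open (g @^-1` V) by move/continuousP: cg; apply.
exists (f @^-1` U), (g @^-1` V), (fun z => p (f z.1, g z.2)); split=> //; last first.
  by move=> w Uw Vw pw; exact: pW.
split=> //; exists n, (fun i => u i \o f), (fun i => v i \o g).
by split=> [i|i|]; [exact: mf|exact: mg|rewrite pE].
Qed.

Lemma subvariety_is_variety (X : fspaceType k) (S : set X) : is_variety X ->
  subvariety S -> is_variety (set_type S).
Proof.
move=> vX sS; have lX := variety_locally_affine vX; split; last first.
  have ms : morphism (set_val : set_type S -> X).
    exact/morphismP/lmorph_set_val.
  have [_ dX] := vX; rewrite -openC.
  have := zprod_map_open ms ms (closed_openC dX).
  congr open; apply/seteqP; split=> -[a b] /= nab ab; apply: nab; first by rewrite ab.
  exact: val_inj.
have [|K [f [fP fS]]] := variety_noetherian vX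
    (F := [set O | open O /\ affine_variety (set_type (S `&` O))]).
  by move=> ? [].
exists #|K|, (fun i => set_val @^-1` (f (enum_val i))); split.
- by move=> i; have [oO _] := fP (enum_val i); exists (f (enum_val i)).
- move=> i; have [_] := fP (enum_val i); apply: affine_variety_iso.
  apply: isomorphic_sym; apply: isomorphic_set_type; last by move=> ? [].
  by move=> a; split=> [fa|[]]//; split=> //; exact: set_valP.
- apply/seteqP; split=> // a _.
  have [O [oO Oa aO]] := subvariety_locally_affine lX sS (set_valP a).
  have [||i fi] := fS (set_val a) O I; [by split|by []|].
  by exists (enum_rank i) => //=; rewrite enum_rankK.
Qed.

End Noetherian.

(** * Definable sets and functions *)

Section Definable.
Variable k : closedFieldType.
Implicit Types (A B : seq k -> Prop) (t : GRing.term k).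

(** [GRing.rformula] excludes inverses, so that eliminating quantifiers leaves polynomial equations
    and inequations. *)
Definition definable A := exists2 f : GRing.formula k, GRing.rformula f &
  forall e, GRing.holds e f <-> A e.

Lemma definable_ext A B : (forall e, A e <-> B e) -> definable A -> definable B.
Proof. by move=> AB [f rf fA]; exists f => // e; rewrite fA. Qed.

Lemma definable_and A B : definable A -> definable B ->
  definable (fun e => A e /\ B e).
Proof.
move=> [f rf fA] [g rg gB]; exists (GRing.And f g); first by rewrite /= rf.
by move=> e /=; rewrite fA gB.
Qed.

Lemma definable_not A : definable A -> definable (fun e => ~ A e).
Proof. by move=> [f rf fA]; exists (GRing.Not f) => // e /=; rewrite fA. Qed.

Lemma definable_forall (I : finType) (A : I -> seq k -> Prop) :
  (forall i, definable (A i)) -> definable (fun e => forall i, A i e).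
Proof.
move=> dA; suff dAs (s : seq I) : definable (fun e => forall i, i \in s -> A i e).
  apply: definable_ext (dAs (enum I)) => e; split=> As i; last by move=> _.
  by apply: As; rewrite mem_enum.
elim: s => [|i s IH]; first by exists (GRing.Bool true).
apply: definable_ext (definable_and (dA i) IH) => e; split=> [[Ai As] j|As].
  by rewrite inE => /predU1P[->|/As].
by split=> [|j js]; apply: As; rewrite inE ?eqxx// js orbT.
Qed.

Lemma definable_exists_fin (I : finType) (A : I -> seq k -> Prop) :
  (forall i, definable (A i)) -> definable (fun e => exists i, A i e).
Proof.
move=> dA.
have := definable_not (definable_forall (fun i => definable_not (dA i))).
apply: definable_ext => e; split=> [nA|[i Ai] /(_ i)//].
by apply: contrapT => /forallNP.
Qed.

Lemma definable_eq0 t : GRing.rterm t -> definable (fun e => GRing.eval e t = 0).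
Proof. by move=> rt; exists (GRing.Equal t (GRing.Const 0)); rewrite //= rt. Qed.

(** The variables below [N] are reserved for the point of the image; the next [m] hold the
    coordinates of the point to be quantified over. *)
Lemma mpoly_term N m (p : mpoly m k) : exists2 t, GRing.rterm t &
  forall e, GRing.eval e t = meval (fun i : 'I_m => e`_(N + i)) p.
Proof.
move: p; apply: mpoly_ring_ind => [c|i|p q [t rt tp] [u ru uq]|p q [t rt tp] [u ru uq]].
- by exists (GRing.Const c) => // e; rewrite mevalC.
- by exists (GRing.Var k (N + i)) => // e; rewrite mevalXU.
- by exists (GRing.Add t u) => [|e]; rewrite /= ?rt// mevalD tp uq.
- by exists (GRing.Mul t u) => [|e]; rewrite /= ?rt// mevalM tp uq.
Qed.

Lemma definable_exists_block N m A : definable A -> definable (fun e =>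
  exists2 e', (forall i, (i < N)%N -> e'`_i = e`_i) /\
    (forall i, (N + m <= i)%N -> e'`_i = e`_i) & A e').
Proof.
move=> [f rf fA]; exists (foldr (GRing.Exists (R := k)) f (iota N m)).
  by elim: (iota N m).
move=> e; rewrite -GRing.foldExistsP; split=> [[e' ee' fe']|[e' [ee' ee'']] Ae'].
  exists e'; last exact/fA.
  split=> i Ni; apply/esym/ee'; rewrite inE mem_iota negb_and -ltnNge -leqNgt.
    by rewrite Ni.
  by rewrite Ni orbT.
exists e'; last exact/fA.
move=> i; rewrite inE mem_iota negb_and -ltnNge -leqNgt.
by case/orP => Ni; [rewrite ee'|rewrite ee''].
Qed.

(** The image of a principal open part of a closed set under the rational map with components
    [P j / Q j], provided that [g] vanishes wherever some [Q j] does. Denominators are cleared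
    because the terms contain no inverse. *)
Lemma definable_rational_image N m (I : finType) (E : I -> mpoly m k)
    (g : mpoly m k) (P Q : 'I_N -> mpoly m k) :
  definable (fun e => exists z : affine k m, [/\ forall i, peval (E i) z = 0,
    peval g z != 0 & forall j : 'I_N, e`_j * peval (Q j) z = peval (P j) z]).
Proof.
have defE (p : mpoly m k) :
    definable (fun e => meval (fun i : 'I_m => e`_(N + i)) p = 0).
  have [t rt tp] := mpoly_term N p.
  by apply: definable_ext (definable_eq0 rt) => e; rewrite tp.
have defQ (j : 'I_N) : definable (fun e =>
    e`_j * meval (fun i : 'I_m => e`_(N + i)) (Q j) =
    meval (fun i : 'I_m => e`_(N + i)) (P j)).
  have [t rt tp] := mpoly_term N (P j); have [u ru uq] := mpoly_term N (Q j).
  have := @definable_eq0 (GRing.Add (GRing.Mul (GRing.Var k j) u) (GRing.Opp t)).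
  rewrite /= rt ru => /(_ isT); apply: definable_ext => e; rewrite tp uq.
  by split=> [/eqP|->]; rewrite ?subrr// subr_eq0 => /eqP.
have := definable_exists_block N m (definable_and
  (definable_forall (fun i => defE (E i)))
  (definable_and (definable_not (defE g)) (definable_forall defQ))).
apply: definable_ext => e; split=> [[e' [ee' _] [E0 [g0 PQ]]]|[z [E0 g0 PQ]]].
  pose z : affine k m := \row_i e'`_(N + i).
  have zE p : peval p z = meval (fun i : 'I_m => e'`_(N + i)) p.
    by apply: meval_eq => i; rewrite mxE.
  exists z; split=> [i||j]; rewrite ?zE//; first exact/eqP.
  by rewrite -ee'.
pose f i := if (i < N)%N then e`_i else if insub (i - N)%N is Some j
  then (z : 'rV[k]_m) ord0 j else e`_i.
have fE (p : mpoly m k) :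
    meval (fun i : 'I_m => (mkseq f (size e + (N + m)))`_(N + i)) p = peval p z.
  apply: meval_eq => i.
  rewrite nth_mkseq; last by rewrite ltn_addl// ltn_add2l.
  by rewrite /f ltnNge leq_addr /= addnC addnK valK.
(* This length covers both the block of [z] and whatever [e] contains after it; further entries are
   0 on both sides. *)
exists (mkseq f (size e + (N + m))); first split=> i Ni.
- rewrite nth_mkseq; last by rewrite ltn_addl// ltn_addr.
  by rewrite /f Ni.
- have [ie|ie] := ltnP i (size e + (N + m)); last first.
    rewrite !nth_default ?size_mkseq//.
    by rewrite (leq_trans _ ie)// leq_addr.
  rewrite nth_mkseq// /f ltnNge (leq_trans _ Ni) ?leq_addr//=.
  by rewrite insubF// ltnNge leq_subRL ?Ni// (leq_trans _ Ni)// leq_addr.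
- split=> [i|]; first by rewrite fE.
  split=> [|j]; first by rewrite fE; exact/eqP.
  rewrite !fE nth_mkseq; last by rewrite ltn_addl// ltn_addr.
  by rewrite /f ltn_ord.
Qed.

(** A formula can only hold finitely many equations. Noetherianity selects finitely many principal
    open sets that fill the complement of [Z]. *)
Lemma closed_affine_zeros n (Z : set (affine k n)) : closed Z ->
  exists (I : finType) (E : I -> mpoly n k),
    Z = [set z | forall i, peval (E i) z = 0].
Proof.
move=> cZ.
have [|I [f [fF fP]]] := @noetherian_affine k n [set O | exists2 g,
    O = [set z | peval g z != 0] & forall z, peval g z != 0 -> ~ Z z].
  by move=> _ [g -> _]; exact: open_peval_neq0.
have /choice[E fE] : forall i, exists g, f i = [set z | peval g z != 0] /\
    forall z, peval g z != 0 -> ~ Z z.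
  by move=> i; have [g fi gZ] := fF i; exists g.
exists I, E; apply/seteqP; split=> z.
  move=> Zz i; apply/eqP; apply: contrapT => /negP Ei.
  by have [_ /(_ z Ei)] := fE i.
move=> E0; apply: contrapT => nZz.
have [g gz gZ] := affine_open_basis (closed_openC cZ) nZz.
have [||i] := fP z [set z | peval g z != 0] Logic.I => //.
  by exists g.
by have [-> _] := fE i; rewrite /= E0 eqxx.
Qed.

(* Chevalley's theorem. *)
Lemma definable_image (X : fspaceType k) (O : set X) N (u : 'I_N -> X -> k) :
  is_variety X -> open O -> (forall j, locreg O (u j)) ->
  definable (fun e => exists2 x, O x & forall j : 'I_N, e`_j = u j x).
Proof.
move=> vX oO ru; have lX := variety_locally_affine vX.
pose F := [set V | open V /\
  definable (fun e => exists2 x, (O `&` V) x & forall j : 'I_N, e`_j = u j x)].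
have loc x : O x -> exists2 V, F V & V x.
  move=> Ox; have [m [U [Z [a [a' [Ux ch]]]]]] := lX x.
  have /choice[P /choice[Q PQ]] : forall j, exists p q, peval q (a x) != 0 /\
      forall y, O y -> U y -> peval q (a y) != 0 -> u j y = peval p (a y) / peval q (a y).
    by move=> j; have := chart_locregP ch (ru j) Ox Ux.
  have [g gx gO] := chart_basis ch oO Ox Ux.
  (* Where [h] does not vanish, the point lies in [O] and all the fractions are valid at once. *)
  pose h := g * \prod_j Q j.
  have hE z : (peval h z != 0) = (peval g z != 0) && [forall j, peval (Q j) z != 0].
    rewrite /h pevalM mulf_eq0 negb_or; congr (_ && _).
    have -> : peval (\prod_j Q j) z = \prod_j peval (Q j) z.
      by elim/big_ind2 : _ => [|p b q c <- <-|//]; [exact: meval1|rewrite pevalM].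
    by apply/prodf_neq0/forallP => Qz j; have := Qz j; [apply|].
  exists [set y | U y /\ peval h (a y) != 0]; last first.
    split=> //=; rewrite hE gx; apply/forallP => j.
    by have [] := PQ j.
  split; first exact: chart_open ch _.
  have [I [E ZE]] := closed_affine_zeros (chart_im_closed ch).
  apply: definable_ext (definable_rational_image E h P Q) => e.
  split=> [[z [E0 hz ePQ]]|[y [Oy [Uy hy]] eu]].
    have Zz : Z z by rewrite ZE.
    have Uz := chart_dom ch Zz; have az := chart_invK ch Zz.
    move: (hz); rewrite hE => /andP[gz /forallP Qz].
    have Oz : O (a' z) by apply: gO; rewrite ?az.
    exists (a' z); first by split=> //; split=> //; rewrite az.
    move=> j; have [_ ->//] := PQ j; rewrite az//.
    by rewrite -ePQ mulfK.
  have : Z (a y) by exact: chart_im ch _ Uy.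
  rewrite ZE => E0; exists (a y); split=> // j.
  move: hy; rewrite hE => /andP[gz /forallP Qz].
  by have [_ uj] := PQ j; rewrite eu uj// divfK.
have [|I [f [fF fP]]] := variety_noetherian vX (F := F); first by move=> ? [].
have := definable_exists_fin (fun i => (fF i).2).
apply: definable_ext => e; split=> [[i [x [Ox _] eu]]|[x Ox eu]]; first by exists x.
have [V FV Vx] := loc x Ox; have [i fi] := fP x V Logic.I FV Vx.
by exists i, x.
Qed.

End Definable.

(** * Functions with definable graph *)

Section DefinableFunction.
Variables (k : closedFieldType) (hk : [pchar k] =i pred0) (n : nat).

Definition graph_env (a : affine k n) (t : k) : seq k :=
  rcons [seq (a : 'rV[k]_n) ord0 i | i <- enum 'I_n] t.

Lemma nth_graph_env a t (i : 'I_n) : (graph_env a t)`_i = (a : 'rV[k]_n) ord0 i.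
Proof.
rewrite nth_rcons size_map size_enum_ord ltn_ord (nth_map i) ?size_enum_ord//.
by rewrite nth_ord_enum.
Qed.

Lemma nth_graph_env_last a t : (graph_env a t)`_n = t.
Proof. by rewrite nth_rcons size_map size_enum_ord ltnn eqxx. Qed.

Let B : set (affine k n -> k) := [set f | exists p, f = peval p].

Let B_cst c : B (fun=> c).
Proof. by exists (mpolyC n c); apply/funext => x; rewrite pevalC. Qed.

Let B_add f g : B f -> B g -> B (fun a => f a + g a).
Proof. by move=> [p ->] [q ->]; exists (p + q); apply/funext => x; rewrite pevalD. Qed.

Let B_mul f g : B f -> B g -> B (fun a => f a * g a).
Proof. by move=> [p ->] [q ->]; exists (p * q); apply/funext => x; rewrite pevalM. Qed.

(** The variable of index [n], which carries the value of the function, becomes the indeterminate,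
    while [a] fixes the others. [GRing.Inv] gets a default value, as [term_polyE] concerns
    inverse-free terms. *)
Fixpoint term_poly (a : affine k n) (t : GRing.term k) : {poly k} :=
  match t with
  | GRing.Var i => if i == n then 'X else ((graph_env a 0)`_i)%:P
  | GRing.Const c => c%:P
  | GRing.NatConst m => m%:R%:P
  | GRing.Add t u => term_poly a t + term_poly a u
  | GRing.Opp t => - term_poly a t
  | GRing.NatMul t m => m%:R%:P * term_poly a t
  | GRing.Mul t u => term_poly a t * term_poly a u
  | GRing.Inv t => 0
  | GRing.Exp t m => term_poly a t ^+ m
  end.

Lemma term_polyE a x t : GRing.rterm t ->
  (term_poly a t).[x] = GRing.eval (graph_env a x) t.
Proof.
elim: t => //= [i _|c _|m _|t IHt u IHu /andP[rt ru]|t IH rt|t IH m rt|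
  t IHt u IHu /andP[rt ru]|t IH m rt]; rewrite ?hornerE//.
- have [->|ni] := eqVneq i n; first by rewrite hornerX nth_graph_env_last.
  rewrite hornerC /graph_env !nth_rcons size_map size_enum_ord (negPf ni).
  by [].
- by rewrite IHt// IHu.
- by rewrite IH.
- by rewrite IH// mulr_natl.
- by rewrite IHt// IHu.
- by rewrite IH.
Qed.

Lemma term_poly_pw t : pwpoly B (fun a => term_poly a t).
Proof.
elim: t => /= [i|c|m|t IHt u IHu|t IH|t IH m|t IHt u IHu|t _|t IH m].
- have [_|ni] := eqVneq i n; first exact: pwpoly_cst.
  apply: pwpolyC => //; apply: pwrat_base => //.
  have [ni'|ni'] := ltnP i n.
    exists (mpolyX k (mnm1 (Ordinal ni'))); apply/funext => a.
    by rewrite peval_X -(nth_graph_env a 0).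
  rewrite (_ : (fun a => _) = fun=> 0)//; apply/funext => a.
  by rewrite nth_default// size_rcons size_map size_enum_ord ltn_neqAle eq_sym ni.
- exact: pwpoly_cst.
- exact: pwpoly_cst.
- exact: pwpolyD.
- exact: pwpolyN.
- by apply: pwpolyM => //; exact: pwpoly_cst.
- exact: pwpolyM.
- exact: pwpoly_cst.
- exact: pwpolyX.
Qed.

Lemma definable_function_pwrat (G : seq k -> Prop) (S : set (affine k n))
    (h : affine k n -> k) : definable G ->
  (forall a t, S a -> G (graph_env a t) <-> t = h a) ->
  exists (I : finType) (r g : I -> mpoly n k), forall a, S a ->
    exists i, peval (g i) a != 0 /\ h a = peval (r i) a / peval (g i) a.
Proof.
move=> [f rf fG] Gh.
pose ex_elim := @ClosedFieldQE.ex_elim k.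
have wf : GRing.wf_QE_proj ex_elim := @ClosedFieldQE.wf_ex_elim k.
have cl : GRing.closed_field_axiom k by exact: solve_monicpoly.
have vl : GRing.valid_QE_proj ex_elim := ClosedFieldQE.holds_ex_elim cl.
pose f' := GRing.quantifier_elim ex_elim f.
have /andP[qf' rf'] : GRing.qf_form f' && GRing.rformula f'.
  exact: GRing.quantifier_elim_wf.
pose bcs := GRing.qf_to_dnf f' false.
have rbcs : all (@GRing.dnf_rterm k) bcs := GRing.qf_to_dnf_rterm false rf'.
pose clause i e := all (fun t => GRing.eval e t == 0) (nth ([::], [::]) bcs i).1 &&
  all (fun t => GRing.eval e t != 0) (nth ([::], [::]) bcs i).2.
have GE e : G e <-> exists2 i, (i < size bcs)%N & clause i e.
  rewrite -fG; apply: iff_trans (rwP (GRing.quantifier_elim_rformP wf vl e rf)) _.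
  rewrite -/f' -GRing.qf_to_dnfP ?qf'// -/bcs /clause.
  elim: bcs {rbcs clause} => [|[ps qs] bcs IH] /=; first by split=> // -[].
  have -> : GRing.qf_eval e
      (foldr (fun t => GRing.And (GRing.Equal t (GRing.NatConst k 0)))
        (GRing.Bool true) ps) = all (fun t => GRing.eval e t == 0) ps.
    by elim: ps => //= t ps ->.
  have -> : GRing.qf_eval e
      (foldr (fun t => GRing.And (GRing.Not (GRing.Equal t (GRing.NatConst k 0))))
        (GRing.Bool true) qs) = all (fun t => GRing.eval e t != 0) qs.
    by elim: qs => //= t qs ->.
  split=> [/orP[psqs|/IH[i ib ie]]|[[|i] ib ie]]; first by exists 0.
  - by exists i.+1.
  - by rewrite ie.
  - by apply/orP; right; apply/IH; exists i.
have root_clause (i : 'I_(size bcs)) : exists2 hi, pwrat B hi & forall a t0,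
    (forall t, clause i (graph_env a t) <-> t = t0) ->
    hi a = t0.
  have := all_nthP ([::], [::]) rbcs i (ltn_ord i); rewrite /clause.
  case: (nth _ bcs i) => ps qs /andP[/= rps rqs].
  (* The inequations of a clause are merged into a single one by taking their product. *)
  have [||hi phi hiP] := pwrat_unique_root hk B_cst B_add B_mul
      (ps := [seq (fun a => term_poly a t) | t <- ps])
      (q := fun a => \prod_(t <- qs) term_poly a t).
  - move=> j; rewrite size_map => jps.
    by rewrite (nth_map (GRing.Const 0))//; exact: term_poly_pw.
  - elim: qs {rqs} => [|t qs IH].
      have := pwpoly_cst B_cst 1; congr pwpoly; apply/funext => a.
      by rewrite big_nil.
    have := pwpolyM B_cst B_add B_mul (term_poly_pw t) IH.
    by congr pwpoly; apply/funext => a; rewrite big_cons.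
  exists hi => // a t0 aP; apply: hiP => t; rewrite -aP.
  have -> : all (fun p => root (p a) t) [seq (fun a => term_poly a u) | u <- ps] =
      all (fun u => GRing.eval (graph_env a t) u == 0) ps.
    elim: ps rps {aP} => //= u ps IH /andP[ru rps].
    by rewrite IH// /root term_polyE.
  have -> // : ~~ root (\prod_(u <- qs) term_poly a u) t =
      all (fun u => GRing.eval (graph_env a t) u != 0) qs.
  elim: qs rqs {aP} => [_|u qs IH /= /andP[ru rqs]].
    by rewrite big_nil (negPf (root1 _)).
  by rewrite big_cons rootM negb_or IH// /root term_polyE.
have /(_ _)/cid2-/all_sig2[hi phi hiP] := root_clause.
(* [pwrat] constrains every point of affine space, so [h] is extended by 0 outside [S]; the index
   [None] accounts for this value. *)
pose h' a := if `[< S a >] then h a else 0.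
have : pwrat B h'.
  apply: (@pwrat_select k _ B _ (fun i => if i is Some i then hi i else fun=> 0)).
    by case=> [i|]; [exact: phi|exact: pwrat_cst].
  move=> a; rewrite /h'; case: asboolP => Sa; last by exists None.
  have /GE[i ib ie] : G (graph_env a (h a)) by apply/Gh.
  exists (Some (Ordinal ib)) => /=; apply/esym/hiP => t /=; split=> [it|->//].
  by apply/(Gh a) => //; apply/GE; exists i.
move=> [I [r [g [rg h'P]]]].
have /choice[r' r'E] : forall i, exists p, r i = peval p by move=> i; have [] := rg i.
have /choice[g' g'E] : forall i, exists p, g i = peval p by move=> i; have [] := rg i.
exists I, r', g' => a Sa; have [i [gi hi']] := h'P a.
by exists i; rewrite -r'E -g'E -hi' /h' asboolT.
Qed.

End DefinableFunction.

(** * Generic regularity *)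

Section GenericRegularity.
Variables (k : closedFieldType) (hk : [pchar k] =i pred0).
Variables (X A : fspaceType k) (p : X -> A).
Hypotheses (vX : is_variety X) (vA : is_variety A) (mp : morphism p).
Hypothesis p_surj : forall a, exists x, p x = a.
Hypothesis p_quot : forall S, open (p @^-1` S) -> open S.

Let lX := variety_locally_affine vX.
Let lA := variety_locally_affine vA.

Let lmp (S : set X) : lmorph S p.
Proof. by apply: lmorph_sub (proj1 (morphismP p) mp). Qed.

Let open_preim (O : set A) : open O -> open (p @^-1` O).
Proof. by have [/continuousP cp _] := mp; exact: cp. Qed.

(** In chart coordinates the graph of [h] is the image of an open subset of [X] under regular
    functions: the coordinates of [a \o p], then [h \o p]. By Chevalley it is definable, although
    [h] is not known to be regular. *)
Lemma descent_pwrat n (U : set A) (Z : set (affine k n)) a a' (O : set A)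
    (h : A -> k) : chart U Z a a' -> open O -> O `<=` U ->
  locreg (p @^-1` O) (h \o p) ->
  exists (I : finType) (r g : I -> mpoly n k), forall b, O b ->
    exists i, peval (g i) (a b) != 0 /\
      h b = peval (r i) (a b) / peval (g i) (a b).
Proof.
move=> ch oO OU rh.
pose u (j : 'I_n.+1) x := if unlift ord_max j is Some i
  then (a (p x) : 'rV[k]_n) ord0 i else h (p x).
have ru j : locreg (p @^-1` O) (u j).
  rewrite /u; case: unlift => [i|//].
  have rc : locreg setT (fun z : affine k n => (z : 'rV[k]_n) ord0 i).
    apply: locreg_eq (@locreg_peval k n (mpolyX k (mnm1 i)) setT) => z _.
    exact: peval_X.
  have map : lmorph (p @^-1` O) (a \o p).
    by apply: lmorph_comp (@lmp _) (chart_lmorph ch) _ => x; exact: OU.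
  exact: (locreg_comp map rc).
have [|I [r [g rgP]]] := definable_function_pwrat hk
  (S := [set z | Z z /\ O (a' z)]) (h := h \o a')
  (definable_image vX (open_preim oO) ru).
  move=> z t [Zz Oz]; split=> [[x Ox zu]|->].
    have zE : z = a (p x).
      apply/rowP => i; have := zu (lift ord_max i).
      by rewrite /u liftK /= /bump leqNgt ltn_ord add0n nth_graph_env.
    have := zu ord_max; rewrite /u unlift_none /= nth_graph_env_last => ->.
    by rewrite zE (chartK ch)//; exact: OU.
  have [x xz] := p_surj (a' z).
  exists x; first by rewrite /= xz.
  move=> j; rewrite /u; case: (unliftP ord_max j) => [i|] ->.
    by rewrite /= /bump leqNgt ltn_ord add0n nth_graph_env xz (chart_invK ch).
  by rewrite /= nth_graph_env_last xz.
exists I, r, g => b Ob; have Ub := OU _ Ob.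
have [|i] := rgP (a b).
  by split; [exact: chart_im ch _ Ub|rewrite (chartK ch)].
by rewrite /= (chartK ch)//; exists i.
Qed.

(** Candidate fractions are eliminated one by one. If [g i] vanishes on all of [S] within [O], index
    [i] is dropped; if [h] differs from fraction [i] somewhere, [O] shrinks to the open set [E i]
    and [i] is dropped; otherwise fraction [i] represents [h] on the part of [S] in [D i]. The list
    cannot run out, as each point uses one of its members. *)
Lemma generic_regular n (U : set A) (Z : set (affine k n)) a a' (O1 : set A)
    (h : A -> k) : chart U Z a a' -> open O1 -> O1 `<=` U ->
  locreg (p @^-1` O1) (h \o p) ->
  forall (S O : set A), open O -> O `<=` O1 -> S `&` O !=set0 ->
  exists O', [/\ open O', O' `<=` O, S `&` O' !=set0 & locreg (S `&` O') h].
Proof.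
move=> ch oO1 OU rh S; have [I [r [g rgP]]] := descent_pwrat ch oO1 OU rh.
pose D i := [set b | U b /\ peval (g i) (a b) != 0].
have oD i : open (D i) by exact: chart_open ch _.
pose E i := [set b | (O1 `&` D i) b /\
  h b - peval (r i) (a b) / peval (g i) (a b) != 0].
have oE i : open (E i).
  apply: p_quot; have oOD : open (p @^-1` (O1 `&` D i)).
    by apply: open_preim; exact: openI.
  have rf : locreg (O1 `&` D i)
      (fun b => - (peval (r i) (a b) / peval (g i) (a b))).
    apply: (@locreg_eq _ _ _ (fun b =>
      (-1) * (peval (r i) (a b) / peval (g i) (a b)))).
      by move=> b _; rewrite mulN1r.
    apply: locregM; first exact: locreg_cst.
    by apply: (chart_frac_locreg ch) => b [_ []].
  apply: (locreg_open_neq0 lX oOD); apply: locregD.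
    by apply: locreg_sub rh => x [].
  exact: (locreg_comp (@lmp _) rf).
suff cover (s : seq I) O : open O -> O `<=` O1 -> S `&` O !=set0 ->
    (forall b, S b -> O b -> exists2 i, i \in s & peval (g i) (a b) != 0 /\
      h b = peval (r i) (a b) / peval (g i) (a b)) ->
    exists O', [/\ open O', O' `<=` O, S `&` O' !=set0 & locreg (S `&` O') h].
  move=> O oO OO1 SO; apply: (cover (enum I)) => // b _ Ob.
  by have [i gi] := rgP b (OO1 _ Ob); exists i; rewrite ?mem_enum.
elim: s O => [|i s IH] O oO OO1 SO sO.
  by have [b [Sb Ob]] := SO; have [] := sO b Sb Ob.
have [[b [Sb [Ob Db]]]|noD] := pselect (S `&` (O `&` D i) !=set0); last first.
  apply: IH => // b Sb Ob; have [j + [gj hj]] := sO b Sb Ob.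
  rewrite inE => /predU1P[ji|js]; last by exists j.
  by case: noD; exists b; split=> //; split=> //; split; rewrite -?ji//; exact/OU/OO1.
have [[c [Sc [Oc Ec]]]|noE] := pselect (S `&` (O `&` E i) !=set0).
  have [||||O' [oO' O'O SO' rO']] := IH (O `&` E i).
  - exact: openI.
  - by move=> ? [/OO1].
  - by exists c.
  - move=> d Sd [Od Ed]; have [j + [gj hj]] := sO d Sd Od.
    rewrite inE => /predU1P[ji|js]; last by exists j.
    by move: Ed => [_]; rewrite -ji hj subrr eqxx.
  by exists O'; split=> //; apply: subset_trans O'O _ => ? [].
exists (O `&` D i); split.
- exact: openI.
- by move=> ? [].
- by exists b.
- apply: (@locreg_eq _ _ _ (fun b => peval (r i) (a b) / peval (g i) (a b))).
    move=> c [Sc [Oc Dc]]; apply/esym/eqP; rewrite -subr_eq0.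
    apply: contrapT => /negP hc; apply: noE; exists c; split=> //; split=> //.
    by split=> //; split=> //; exact: OO1.
  by apply: (chart_frac_locreg ch) => c [_ [_ []]].
Qed.

Lemma generic_morphism (B : fspaceType k) (q : X -> B) (phi : A -> B) :
  is_variety B -> morphism q -> (forall x, phi (p x) = q x) ->
  forall S O : set A, open O -> S `&` O !=set0 ->
  exists O', [/\ open O', O' `<=` O, S `&` O' !=set0 & lmorph (S `&` O') phi].
Proof.
move=> vB mq phip S O oO [b [Sb Ob]].
have [n [U [Z [a [a' [Ub ch]]]]]] := lA b.
have [m [V [Z' [c [c' [Vb ch']]]]]] := variety_locally_affine vB (phi b).
have oV : open (phi @^-1` V).
  apply: p_quot; have [/continuousP cq _] := mq.
  have := cq _ (chart_dom_open ch'); congr open.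
  by apply/funext => x /=; rewrite phip.
pose O1 := O `&` U `&` phi @^-1` V.
have oO1 : open O1.
  by apply: openI => //; apply: openI => //; exact: chart_dom_open ch.
pose h (j : 'I_m) y := (c (phi y) : 'rV[k]_m) ord0 j.
have rh j : locreg (p @^-1` O1) (h j \o p).
  have rc : locreg setT (fun z : affine k m => (z : 'rV[k]_m) ord0 j).
    apply: locreg_eq (@locreg_peval k m (mpolyX k (mnm1 j)) setT) => z _.
    exact: peval_X.
  have mcq : lmorph (p @^-1` O1) (c \o q).
    apply: lmorph_comp (lmorph_sub _ ((morphismP q).1 mq)) (chart_lmorph ch') _ => //.
    by move=> x [_]; rewrite /= phip.
  apply: locreg_eq (locreg_comp mcq rc _) => // x _.
  by rewrite /h /= phip.
(* The coordinates are treated in turn; each shrinks the open set further while it still meets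
   [S]. *)
have [O' [oO' O'O1 SO' rO']] : exists O', [/\ open O', O' `<=` O1,
    S `&` O' !=set0 & forall j, j \in enum 'I_m -> locreg (S `&` O') (h j)].
  elim: (enum 'I_m) => [|j s [O' [oO' O'O1 SO' rO']]].
    by exists O1; split=> //; exists b.
  have [|O'' [oO'' O''O' SO'' rO'']] :=
      generic_regular ch oO1 _ (rh j) oO' O'O1 SO'.
    by move=> ? [[]].
  exists O''; split=> //; first exact: subset_trans O'O1.
  move=> i; rewrite inE => /predU1P[->//|/rO'].
  by apply: locreg_sub => y [Sy /O''O'].
exists O'; split=> //; first by move=> y /O'O1[[]].
have mc : lmorph (S `&` O') (c \o phi).
  by apply: lmorph_affine => // j; apply: rO'; rewrite mem_enum.
apply: lmorph_eq (lmorph_comp mc (chart_inv_lmorph ch') _).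
  by move=> y [_ /O'O1[_ Vy]]; exact: chartK ch' _ Vy.
by move=> y [_ /O'O1[_ Vy]]; exact: chart_im ch' _ Vy.
Qed.

End GenericRegularity.

(** * Scissors relations and pseudo-quotients *)

Section Scissors.
Variable k : closedFieldType.

Lemma open_preimage_morphism (X Y : fspaceType k) (f : X -> Y) (O : set Y) :
  morphism f -> open O -> open (f @^-1` O).
Proof. by move=> [/continuousP cf _]; exact: cf. Qed.

Lemma closed_preimage_morphism (X Y : fspaceType k) (f : X -> Y) (F : set Y) :
  morphism f -> closed F -> closed (f @^-1` F).
Proof.
move=> mf cF; rewrite -openC preimage_setC.
by apply: open_preimage_morphism => //; exact: closed_openC.
Qed.

Lemma isomorphic_preimage (X Y : fspaceType k) (f : X -> Y) (g : Y -> X)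
    (B : set Y) : morphism f -> morphism g -> cancel f g -> cancel g f ->
  isomorphic (set_type (f @^-1` B)) (set_type B).
Proof.
move=> /morphismP mf /morphismP mg fg gf.
apply: (isomorphic_on (f := f) (g := g)) => //.
- exact: lmorph_sub mf.
- exact: lmorph_sub mg.
- by move=> y By; rewrite /= gf.
Qed.

(** [keq_scissor] cuts a variety along a closed subset of itself. Here all pieces are subsets of one
    ambient space, which suits an induction on closed subsets. *)
Lemma scissor_set (A : fspaceType k) (VA VY VU : variety k) (Z C : set A) :
  isomorphic VA (set_type Z) -> closed C ->
  isomorphic VY (set_type (Z `&` C)) ->
  isomorphic VU (set_type (Z `&` ~` C)) ->
  keq (KClass VA) (KAdd (KClass VY) (KClass VU)).
Proof.
move=> [f [g [mf mg fg gf]]] cC isoY isoU.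
pose C' : set (set_type Z) := set_val @^-1` C.
have cC' : closed C'.
  rewrite -openC; exists (~` C); first exact: closed_openC.
  by [].
have isoC (D : set A) : isomorphic (set_type (Z `&` D))
    (set_type (f @^-1` (set_val @^-1` D))).
  apply: isomorphic_sym; apply: isomorphic_trans (isomorphic_preimage _ mf mg fg gf) _.
  apply: isomorphic_set_type; last by move=> ? [].
  by move=> a; split=> [Da|[]]//; split=> //; exact: set_valP.
apply: (@keq_scissor _ _ _ _ (f @^-1` C')).
- exact: closed_preimage_morphism.
- exact: isomorphic_trans isoY (isoC C).
- exact: isomorphic_trans isoU (isoC (~` C)).
Qed.

Definition subvariety_variety (A : variety k) (S : set A) (hS : subvariety S) :
  variety k := Variety (subvariety_is_variety (varietyP A) hS).

Lemma subvariety_closed (A : fspaceType k) (Z : set A) : closed Z -> subvariety Z.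
Proof. by move=> cZ; exists setT, Z; split; [exact: openT|exact: cZ|rewrite setTI]. Qed.

Lemma subvariety_open (A : fspaceType k) (O : set A) : open O -> subvariety O.
Proof. by move=> oO; exists O, setT; split; [exact: oO|exact: closedT|rewrite setIT]. Qed.

Lemma locally_affine_closed1 (A : fspaceType k) (a : A) :
  locally_affine A -> closed [set a].
Proof.
move=> lA; rewrite -openC; apply: open_local => b /= ba.
have [n [U [Z [c [c' [Ub ch]]]]]] := lA b.
have [Ua|nUa] := pselect (U a); last first.
  exists U; split=> //; first exact: chart_dom_open ch.
  by move=> d Ud da; apply: nUa; rewrite -da.
have [i ci] : exists i, (c b : 'rV[k]_n) ord0 i != (c a : 'rV[k]_n) ord0 i.
  apply: contrapT => /forallNP cab; apply: ba.
  rewrite -(chartK ch Ub) -(chartK ch Ua); congr c'; apply/rowP => i.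
  by apply/eqP; apply: contrapT => /negP; exact: cab.
pose g := mpolyX k (mnm1 i) + mpolyC n (- (c a : 'rV[k]_n) ord0 i).
have gE z : peval g z = (z : 'rV[k]_n) ord0 i - (c a : 'rV[k]_n) ord0 i.
  by rewrite pevalD peval_X pevalC.
exists [set d | U d /\ peval g (c d) != 0]; split.
- exact: chart_open ch _.
- by split=> //; rewrite gE subr_eq0.
- by move=> d [_ gd] da; move: gd; rewrite da gE subrr eqxx.
Qed.

End Scissors.

Section SameFibres.
Variables (k : closedFieldType) (hk : [pchar k] =i pred0).
Variables (X : fspaceType k) (A B : variety k) (p : X -> A) (q : X -> B).
Hypotheses (vX : is_variety X) (mp : morphism p) (mq : morphism q).
Hypotheses (p_surj : forall a, exists x, p x = a).
Hypotheses (q_surj : forall b, exists x, q x = b).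
Hypotheses (p_quot : forall S, open (p @^-1` S) -> open S).
Hypotheses (q_quot : forall S, open (q @^-1` S) -> open S).
Hypothesis fibres : forall x y, p x = p y <-> q x = q y.

(** The hypotheses only involve fibres and quotient topologies, so that the result also applies to
    the restriction of a pseudo-quotient to a saturated piece, with no need to prove separation for
    it. *)
Lemma same_fibres_keq : keq (KClass A) (KClass B).
Proof.
have [s sK] := choice p_surj; have [t tK] := choice q_surj.
(* By [fibres], these maps do not depend on the sections [s] and [t]. *)
pose phi a := q (s a); pose psi b := p (t b).
have phip x : phi (p x) = q x by apply/fibres; rewrite sK.
have psiq x : psi (q x) = p x by apply/fibres; rewrite tK.
have phiK : cancel phi psi by move=> a; rewrite /phi psiq.
have psiK : cancel psi phi by move=> b; rewrite /psi phip.
have opsi (O : set A) : open O -> open (psi @^-1` O).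
  move=> oO; apply: q_quot; have [/continuousP cp _] := mp.
  by have := cp _ oO; congr open; apply/funext => x /=; rewrite psiq.
have ophi (O : set B) : open O -> open (phi @^-1` O).
  move=> oO; apply: p_quot; have [/continuousP cq _] := mq.
  by have := cq _ oO; congr open; apply/funext => x /=; rewrite phip.
suff H (Z : set A) : closed Z -> forall VA VB : variety k,
    isomorphic VA (set_type Z) -> isomorphic VB (set_type (psi @^-1` Z)) ->
    keq (KClass VA) (KClass VB).
  apply: (H setT); [exact: closedT|exact: isomorphic_setT|].
  exact: isomorphic_setT.
move: Z; apply: (noetherian_closed_ind (variety_noetherian (varietyP A))).
move=> Z cZ IH VA VB isoA isoB.
have [[z Zz]|Z0] := pselect (Z !=set0); last first.
  have ZE : Z = set0 by apply/seteqP; split=> // x Zx; case: Z0; exists x.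
  apply: keq_iso; rewrite ZE preimage_set0 in isoA isoB.
  apply: isomorphic_trans isoA (isomorphic_trans _ (isomorphic_sym isoB)).
  exact: isomorphic_set0.
have [|O1 [oO1 _ [z1 [Zz1 O1z1]] mphi]] := generic_morphism hk vX (varietyP A) mp
    p_surj p_quot (varietyP B) mq phip (S := Z) openT.
  by exists z.
(* Searching inside the preimage of [O1] under [psi] gives a piece where [psi] is a morphism and
   whose counterpart in [Z] stays where [phi] is one. *)
have [|O2 [oO2 O21 [z2 [Zz2 O2z2]] mpsi]] := generic_morphism hk vX (varietyP B) mq
    q_surj q_quot (varietyP A) mp psiq (S := psi @^-1` Z) (opsi _ oO1).
  by exists (phi z1); rewrite /setI /= phiK.
pose O := phi @^-1` O2.
have oO : open O by exact: ophi.
have OO1 : O `<=` O1 by move=> a /O21; rewrite /= phiK.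
have cO : closed (~` O) by exact: open_closedC.
have sZ : subvariety (Z `&` ~` O) by apply: subvariety_closed; exact: closedI.
have sU : subvariety (Z `&` O) by exists O, Z; split=> //; rewrite setIC.
have sZ' : subvariety (psi @^-1` (Z `&` ~` O)).
  apply: subvariety_closed; rewrite -openC preimage_setC; apply: opsi.
  by rewrite openC; exact: closedI.
have sU' : subvariety (psi @^-1` (Z `&` O)).
  exists (psi @^-1` O), (psi @^-1` Z); split; first exact: opsi.
    by rewrite -openC preimage_setC; apply: opsi; exact: closed_openC.
  by rewrite preimage_setI setIC.
have scA := scissor_set isoA cO
  (VY := subvariety_variety sZ) (VU := subvariety_variety sU)
  (isomorphic_refl _).
have scB := scissor_set isoB (C := psi @^-1` (~` O))
  (VY := subvariety_variety sZ') (VU := subvariety_variety sU').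
apply: keq_trans (scA _) _; first by rewrite setCK; exact: isomorphic_refl.
apply: keq_sym; apply: keq_trans (scB _ _ _) _.
- by rewrite -openC preimage_setC setCK; exact: opsi.
- exact: isomorphic_refl.
- by rewrite preimage_setC setCK -preimage_setI; exact: isomorphic_refl.
apply: keq_add; apply: keq_sym.
  apply: (IH (Z `&` ~` O)); try exact: isomorphic_refl.
  - exact: closedI.
  - by move=> ? [].
  - apply/eqP => ZO; have : (Z `&` ~` O) (psi z2) by rewrite ZO.
    by move=> [_]; apply; rewrite /O /= psiK.
apply: keq_iso; apply: (isomorphic_on (f := phi) (g := psi)) => //.
- by apply: lmorph_sub mphi => a [Za /OO1].
- by apply: lmorph_sub mpsi => b [Zb]; rewrite /O /= psiK.
- by move=> a; rewrite /= phiK.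
Qed.

End SameFibres.

(** * Fibres and topology of pseudo-quotients *)

Section PseudoQuotients.
Variable k : closedFieldType.

Section Quotient.
Variables (G : Type) (X : fspaceType k) (act : G -> X -> X) (A : variety k).
Variables (p : X -> A) (hp : pseudo_quotient act p).

Lemma fibre_closed a : closed (p @^-1` [set a]).
Proof.
apply: closed_preimage_morphism (pq_morphism hp) _.
exact/locally_affine_closed1/variety_locally_affine/varietyP.
Qed.

Lemma preimage_invariant (S : set A) : Defs.invariant act (p @^-1` S).
Proof. by move=> g x; rewrite /= (pq_invariant hp). Qed.

Lemma pseudo_quotient_meet (W1 W2 : set X) a : closed W1 -> closed W2 ->
  Defs.invariant act W1 -> Defs.invariant act W2 -> (p @` W1) a -> (p @` W2) a ->
  exists2 x, W1 x & W2 x.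
Proof.
move=> c1 c2 i1 i2 p1 p2; apply: contrapT => W12.
have W0 : W1 `&` W2 = set0.
  by apply/seteqP; split=> // x [W1x W2x]; apply: W12; exists x.
have /seteqP[+ _] := pq_separated hp c1 c2 i1 i2 W0.
by move/(_ a); apply; split; exact: subset_closure.
Qed.

(** For a point [a] in the closure of [C] but not in [C], the fibre of [a] and the preimage of [C]
    would be disjoint closed invariant sets whose images have meeting closures. *)
Lemma pseudo_quotient_closed (C : set A) : closed (p @^-1` C) -> closed C.
Proof.
move=> cC a Ca; apply: contrapT => nCa.
have W0 : p @^-1` C `&` p @^-1` [set a] = set0.
  by apply/seteqP; split=> // x [/= Cx xa]; apply: nCa; rewrite -xa.
have /seteqP[+ _] := pq_separated hp cC (@fibre_closed a)
  (@preimage_invariant _) (@preimage_invariant _) W0.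
move/(_ a); apply; split.
  rewrite (_ : p @` _ = C)//; apply/seteqP; split=> [_ [x Cx <-]//|b Cb].
  by have [x xb] := pq_surj hp b; exists x => //=; rewrite xb.
by apply: subset_closure; have [x xa] := pq_surj hp a; exists x.
Qed.

Lemma pseudo_quotient_open (S : set A) : open (p @^-1` S) -> open S.
Proof.
move=> oS; rewrite -[S]setCK openC; apply: pseudo_quotient_closed.
by rewrite -preimage_setC; exact: open_closedC.
Qed.

End Quotient.

(** The [q]-fibres through [x] and [y] are closed and invariant, and their images under [p] share
    [p x]; by separation for [p] they have a common point. *)
Lemma pseudo_quotient_fibres (G : Type) (X : fspaceType k) (act : G -> X -> X)
    (A B : variety k) (p : X -> A) (q : X -> B) :
  pseudo_quotient act p -> pseudo_quotient act q ->
  forall x y, p x = p y -> q x = q y.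
Proof.
move=> hp hq x y pxy.
have [||||z <- <-//] := pseudo_quotient_meet hp (a := p x)
    (fibre_closed hq (a := q x)) (fibre_closed hq (a := q y)).
- exact: preimage_invariant.
- exact: preimage_invariant.
- by exists x.
- by exists y.
Qed.

Lemma pseudo_quotient_keq (hk : [pchar k] =i pred0) (G : Type)
    (X : fspaceType k) (act : G -> X -> X) (A B : variety k) (p : X -> A)
    (q : X -> B) : is_variety X ->
  pseudo_quotient act p -> pseudo_quotient act q -> keq (KClass A) (KClass B).
Proof.
move=> vX hp hq; apply: (same_fibres_keq hk vX (pq_morphism hp) (pq_morphism hq)).
- exact: pq_surj hp.
- exact: pq_surj hq.
- by move=> S; exact: (pseudo_quotient_open hp).
- by move=> S; exact: (pseudo_quotient_open hq).
- move=> x y; split; first exact: (pseudo_quotient_fibres hp hq).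
  exact: (pseudo_quotient_fibres hq hp).
Qed.

End PseudoQuotients.

(** * Saturated pieces and cores *)

Section SaturatedPiece.
Variables (k : closedFieldType) (hk : [pchar k] =i pred0).
Variables (G : Type) (X : fspaceType k) (act : G -> X -> X) (A : variety k).
Variables (p : X -> A) (vX : is_variety X) (hp : pseudo_quotient act p).
Variables (D : set X) (satD : saturated p D) (locD : open D \/ closed D).
Variables (Dinv : Defs.invariant act D) (Dbar : variety k).
Variables (pD : set_type D -> Dbar) (hpD : pseudo_quotient (restr_act Dinv) pD).

Lemma saturated_image_subvariety : subvariety (p @` D).
Proof.
case: locD => ?; [apply: subvariety_open|apply: subvariety_closed].
  by apply: (pseudo_quotient_open hp); rewrite satD.
by apply: (pseudo_quotient_closed hp); rewrite satD.
Qed.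

Let q (a : set_type D) : subvariety_variety saturated_image_subvariety :=
  to_set_type (ex_intro2 _ _ (set_val a) (set_valP a) erefl : (p @` D) (p (set_val a))).

Let q_morphism : morphism q.
Proof.
apply/morphismP/lmorph_to_set_type.
have mp := (morphismP p).1 (pq_morphism hp).
exact: (lmorph_comp (@lmorph_set_val _ _ D) mp).
Qed.

Let q_surj c : exists a, q a = c.
Proof.
have [x Dx xc] := set_valP c; exists (to_set_type Dx).
by apply: val_inj; rewrite -[RHS]xc.
Qed.

(** Brings topological questions on the image of [D] back to [X]: by saturation, [p]-preimages of
    its subsets stay inside [D]. *)
Let preim_image (S : set (set_type (p @` D))) (W : set X) :
  q @^-1` S = set_val @^-1` W -> p @^-1` (set_val @` S) = D `&` W.
Proof.
move=> SW; apply/seteqP; split=> [x /= [c Sc cx]|x [Dx Wx]].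
  have Dx : D x by rewrite -satD /= -cx; exact: (set_valP c).
  split=> //; suff : (q @^-1` S) (to_set_type Dx) by rewrite SW.
  by rewrite /= (_ : q _ = c)//; apply: val_inj; exact: esym cx.
exists (q (to_set_type Dx)) => //.
by rewrite -[S _]/((q @^-1` S) (to_set_type Dx)) SW.
Qed.

Let q_quot S : open (q @^-1` S) -> open S.
Proof.
move=> [W oW SW].
have valK (V : set (set_type (p @` D))) : set_val @^-1` (set_val @` V) = V.
  by apply/seteqP; split=> [c [d Vd /val_inj<-]|c Vc]//=; exists c.
case: locD => [oD|cD].
  exists (set_val @` S) => //; apply: (pseudo_quotient_open hp).
  by rewrite (preim_image (esym SW)); exact: openI.
exists (~` (set_val @` (~` S))); last by rewrite -preimage_setC valK setCK.
apply: closed_openC; apply: (pseudo_quotient_closed hp).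
rewrite (@preim_image _ (~` W)); last by rewrite -preimage_setC -SW.
by apply: closedI => //; exact: open_closedC.
Qed.

(** If [pD] identifies [a] and [b], the traces on [D] of their [p]-fibres are closed and invariant,
    and [hpD] makes them meet. Conversely, fibres of [pD] are closed in [D] only; cut down to a
    single [p]-fibre, which lies in [D] by saturation, they become closed in [X] and [hp]
    applies. *)
Let fibres a b : pD a = pD b <-> q a = q b.
Proof.
have qp c d : q c = q d <-> p (set_val c) = p (set_val d).
  by split=> [/(congr1 set_val)//|e]; apply: val_inj; exact: e.
have pmo : morphism (p \o set_val : set_type D -> A).
  apply/morphismP; have mp := (morphismP p).1 (pq_morphism hp).
  exact: (lmorph_comp (@lmorph_set_val _ _ D) mp).
rewrite qp; split=> [pab|pab].
  have cl c : closed ((p \o set_val : set_type D -> A) @^-1` [set c]).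
    apply: closed_preimage_morphism pmo _.
    exact/locally_affine_closed1/variety_locally_affine/varietyP.
  have inv c : Defs.invariant (restr_act Dinv)
      ((p \o set_val : set_type D -> A) @^-1` [set c]).
    by move=> g x /=; rewrite (pq_invariant hp).
  have [||c <- <-//] := pseudo_quotient_meet hpD (a := pD a)
    (cl (p (set_val a))) (cl (p (set_val b))) (@inv _) (@inv _).
  - by exists a.
  - by exists b.
have cl c : exists2 F, closed F & pD @^-1` [set c] = set_val @^-1` F.
  have := closed_openC (fibre_closed hpD (a := c)).
  move=> [W oW WE]; exists (~` W); first exact: open_closedC.
  by rewrite -preimage_setC WE setCK.
have [F cF FE] := cl (pD a); have [F' cF' F'E] := cl (pD b).
pose y := p (set_val a).
have yD x : p x = y -> D x.
  by move=> xy; rewrite -satD /= xy; exists (set_val a) => //; exact: set_valP.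
have inv c W : pD @^-1` [set c] = set_val @^-1` W ->
    Defs.invariant act (W `&` p @^-1` [set y]).
  move=> cW g x [Wx /= xy]; have Dx := yD _ xy.
  split; last by rewrite /= (pq_invariant hp).
  have Wc (d : set_type D) : W (set_val d) <-> pD d = c.
    by rewrite -[W _]/((set_val @^-1` W) d) -cW.
  have := (Wc (restr_act Dinv g (to_set_type Dx))).2; apply.
  by rewrite (pq_invariant hpD); apply/Wc.
have [||x [Fx xy] [F'x _]] := pseudo_quotient_meet hp (a := y)
  (closedI cF (fibre_closed hp (a := y)))
  (closedI cF' (fibre_closed hp (a := y))) (inv _ _ FE) (inv _ _ F'E).
- exists (set_val a) => //; split=> //.
  by rewrite -[F _]/((set_val @^-1` F) a) -FE.
- exists (set_val b); last by rewrite /y -pab.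
  split; last by rewrite /= -pab.
  by rewrite -[F' _]/((set_val @^-1` F') b) -F'E.
have Dx := yD _ xy.
have : (pD @^-1` [set pD a]) (to_set_type Dx) by rewrite FE.
have : (pD @^-1` [set pD b]) (to_set_type Dx) by rewrite F'E.
by move=> /= -> ->.
Qed.

Lemma saturated_piece_keq : keq (KClass Dbar)
  (KClass (subvariety_variety saturated_image_subvariety)).
Proof.
apply: (same_fibres_keq hk _ (pq_morphism hpD) q_morphism).
- apply: subvariety_is_variety vX _.
  by case: locD => ?; [exact: subvariety_open|exact: subvariety_closed].
- exact: pq_surj hpD.
- exact: q_surj.
- by move=> S; exact: (pseudo_quotient_open hpD).
- exact: q_quot.
- exact: fibres.
Qed.

End SaturatedPiece.

(** The complement [Y] of a saturated set is saturated, so the images of [Y] and [U] partition [A]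
    into a closed and an open part. *)
Lemma saturated_decomposition (k : closedFieldType) (hk : [pchar k] =i pred0)
    (G : Type) (X : fspaceType k) (act : G -> X -> X) (A : variety k)
    (p : X -> A) (Y U : set X) (Yinv : Defs.invariant act Y)
    (Uinv : Defs.invariant act U) (Ybar Ubar : variety k)
    (pY : set_type Y -> Ybar) (pU : set_type U -> Ubar) :
  is_variety X -> pseudo_quotient act p -> Y `|` U = setT -> Y `&` U = set0 ->
  closed Y -> open U -> saturated p U ->
  pseudo_quotient (restr_act Yinv) pY -> pseudo_quotient (restr_act Uinv) pU ->
  keq (KClass A) (KAdd (KClass Ybar) (KClass Ubar)).
Proof.
move=> vX hp YUT YU0 cY oU satU hpY hpU.
have YU x : Y x <-> ~ U x.
  split=> [Yx Ux|nUx]; first by have : (Y `&` U) x by []; rewrite YU0.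
  by have : (Y `|` U) x; [rewrite YUT|case].
have satY : saturated p Y.
  apply/seteqP; split=> [x [y Yy yx]|x Yx]; last by exists x.
  apply/YU => Ux; move/YU: Yy; apply.
  by rewrite -satU /= yx; exists x.
have imC : ~` (p @` Y) = p @` U.
  apply/seteqP; split=> [a na|_ [x Ux <-] [y Yy yx]].
    have [x xa] := pq_surj hp a; exists x => //; apply: contrapT => nUx.
    by apply: na; exists x => //; apply/YU.
  by move/YU: Yy; apply; rewrite -satU /= yx; exists x.
have cpY : closed (p @` Y) by apply: (pseudo_quotient_closed hp); rewrite satY.
have EY := saturated_piece_keq hk vX hp satY (or_intror cY) hpY.
have EU := saturated_piece_keq hk vX hp satU (or_introl oU) hpU.
apply: keq_trans (keq_sym (keq_add EY EU)).
apply: (scissor_set (isomorphic_setT A) cpY); rewrite setTI.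
  exact: isomorphic_refl.
by rewrite imC; exact: isomorphic_refl.
Qed.

Lemma locreg_sum (k : closedFieldType) (X : fspaceType k) (S : set X) n
    (F : 'I_n -> X -> k) :
  (forall i, locreg S (F i)) -> locreg S (fun x => \sum_i F i x).
Proof.
elim: n F => [|n IH] F rF.
  by apply: locreg_eq (@locreg_cst k X S 0) => x _; rewrite big_ord0.
apply: locreg_eq (locregD (rF ord0) (IH _ (fun i => rF (lift ord0 i)))) => x _.
by rewrite big_ord_recl.
Qed.

Section Core.
Variables (k : closedFieldType) (G : algGroupType k) (X : fspaceType k).
Variable act : alg_action G X.
Hypothesis vX : is_variety X.

(** The topology of [zprod G X] is finer than the product topology, so slices are examined on basic
    open sets: with [g] fixed, a tensor becomes a regular function on [X]. *)
Lemma act_open g (V : set X) : open V -> open (act g @^-1` V).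
Proof.
have [/continuousP ca _] := alg_act_morphism act => /ca oV.
apply: open_local => x Vx.
have [U [W [p [[oU oW [n [u [v [ru rv pE]]]]] [Ug Wx px] pV]]]] := oV (g, x) Vx.
have rp : locreg W (fun y => p (g, y)).
  rewrite pE /=; apply: locreg_sum => i; apply: locregM; first exact: locreg_cst.
  exact: regular_locreg.
exists [set y | W y /\ p (g, y) != 0]; split=> //.
  exact: locreg_open_neq0 (variety_locally_affine vX) oW rp.
by move=> y [Wy py]; exact: (pV (g, y)).
Qed.

Lemma closure_invariant (W : set X) :
  Defs.invariant act W -> Defs.invariant act (closure W).
Proof.
move=> Winv g x; have cF : closed (act g @^-1` closure W).
  rewrite -openC preimage_setC; apply: act_open.
  by rewrite openC; exact: closed_closure.
suff : closure W `<=` act g @^-1` closure W by apply.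
rewrite [X in _ `<=` X](closure_id _).1//; apply: closureS => y Wy.
by apply: subset_closure; exact: Winv.
Qed.

(** Surjectivity: [p] is constant on the closure of an orbit, and this closure meets [Y].
    Separation: the core condition makes the closures of the translates disjoint, and these are
    closed and [G]-invariant, so [p] separates them and a fortiori the smaller sets [W1] and
    [W2]. *)
Lemma core_pseudo_quotient (Xbar : variety k) (p : X -> Xbar) (Y : set X)
    (H : set G) (hYH : core act Y H) : pseudo_quotient act p ->
  pseudo_quotient (restr_act (core_invariant hYH)) (p \o set_val).
Proof.
move=> hp; have mpv : morphism (p \o set_val : set_type Y -> Xbar).
  apply/morphismP; have mp := (morphismP p).1 (pq_morphism hp).
  exact: (lmorph_comp (@lmorph_set_val _ _ Y) mp).
split=> // [y|h a|W1 W2 cW1 cW2 iW1 iW2 W12].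
- have [x xy] := pq_surj hp y; have [z [zx Yz]] := core_meet hYH x.
  exists (to_set_type Yz); have cF := fibre_closed hp (a := y).
  suff : closure (gorbit act x) `<=` p @^-1` [set y] by apply.
  rewrite [X in _ `<=` X](closure_id _).1//; apply: closureS => _ [g _ <-].
  by rewrite /= (pq_invariant hp).
- exact: (pq_invariant hp).
have cin W : closed W -> closed_in Y (set_val @` (W : set (set_type Y))).
  move=> /closed_openC[O oO OW]; exists (~` O); first exact: open_closedC.
  have WO : W = set_val @^-1` (~` O) by rewrite -preimage_setC OW setCK.
  rewrite WO; apply/seteqP; split=> [_ [a aO <-]|x [Yx Ox]].
    by split=> //; exact: set_valP.
  by exists (to_set_type Yx).
have inv W : Defs.invariant (restr_act (core_invariant hYH)) W ->
    Defs.invariant (act \o set_val : set_type H -> X -> X) (set_val @` W).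
  move=> iW h _ [a Wa <-].
  by exists (restr_act (core_invariant hYH) h a); first exact: iW.
have W0 : set_val @` W1 `&` set_val @` W2 = set0.
  apply/seteqP; split=> // _ [[a W1a <-] [b W2b /val_inj ba]].
  have : (W1 `&` W2) a by split=> //; rewrite -ba.
  by rewrite W12.
have tr W : Defs.invariant act (closure (translates act W)).
  apply: closure_invariant => g _ [w Ww [h _ <-]].
  by exists w => //; exists (g * h)%g => //; rewrite alg_actM.
have := core_separated hYH (cin _ cW1) (cin _ cW2) (inv _ iW1) (inv _ iW2) W0.
move=> /(pq_separated hp (@closed_closure _ _) (@closed_closure _ _) (@tr _) (@tr _)) pS.
have sub W : closure ((p \o set_val) @` W) `<=`
    closure (p @` closure (translates act (set_val @` (W : set (set_type Y))))).
  apply: closureS => _ [a Wa <-]; exists (set_val a) => //.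
  apply: subset_closure; exists (set_val a); first by exists a.
  by exists 1%g => //; rewrite alg_act1.
apply/seteqP; split=> // y [/sub y1 /sub y2].
by rewrite -pS.
Qed.

End Core.

Theorem mainTheorem1 (k : closedFieldType) (hk : [pchar k] =i pred0)
    (G : algGroupType k) (X : variety k) (act : alg_action G X)
    (Xbar : variety k) (p : X -> Xbar) (hp : pseudo_quotient act p) :
  (forall (Xbar' : variety k) (p' : X -> Xbar'),
     pseudo_quotient act p' -> kclass Xbar = kclass Xbar') /\
  (forall (Y U : set X) (hYU : Y `|` U = setT) (hYU0 : Y `&` U = set0)
      (hY : closed Y) (hU : open U) (hsat : saturated p U)
      (Ybar Ubar : variety k)
      (pY : set_type Y -> Ybar) (pU : set_type U -> Ubar),
     pseudo_quotient
       (restr_act (saturated_invariant_compl hp hsat hYU hYU0)) pY ->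
     pseudo_quotient (restr_act (saturated_invariant hp hsat)) pU ->
     kclass Xbar = KVar_add (kclass Ybar) (kclass Ubar)) /\
  (forall (Y : set X) (H : set G) (hYH : core act Y H),
     pseudo_quotient (restr_act (core_invariant hYH)) (p \o set_val)).
Proof.
split=> [Xbar' p' hp'|].
  exact/kpiP/(pseudo_quotient_keq hk (varietyP X) hp hp').
split=> [Y U hYU hYU0 hY hU hsat Ybar Ubar pY pU hpY hpU|Y H hYH].
  rewrite /kclass kaddE; apply/kpiP.
  exact: (saturated_decomposition hk (varietyP X) hp hYU hYU0 hY hU hsat hpY hpU).
exact: (core_pseudo_quotient (varietyP X) hYH hp).
Qed.
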